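(* For any graph class $\mathcal{C}$ the following are equivalent: (i) $\mathcal{C}$ is interpretable in a graph class of tree rank $2$; (ii) $\mathcal{C}$ is a perturbation of a locally almost near-covered graph class.
   Context: Graphs are finite, simple, and may be colored by unary predicates; graph-theoretic properties (such as tree rank) refer to the underlying graph. $N^G(v)$ is the set of neighbors of $v$; $N_r^G(v)$ is the closed $r$-neighborhood (vertices at distance at most $r$ from $v$, including $v$). Tree rank: $T_{d,m}$ is the rooted tree of depth $d$ (all leaf-to-root paths have $d$ edges) in which every non-leaf has exactly $m$ children. $H$ is an $r$-shallow topological minor of $G$ if $G$ has a subgraph isomorphic to a graph obtained from $H$ by replacing each edge by a path with at most $r$ internal vertices (paths internally disjoint). A class has tree rank at most $d$ if for every $r$ there is $m$ such that no graph of the class contains $T_{d,m}$ as an $r$-shallow topological minor; ''tree rank $2$'' means tree rank at most $2$. Interpretations: an interpretation $I=(\psi,\delta)$ consists of first-order formulas $\psi(x,y)$, $\delta(x)$ in the signature of (colored) graphs, with $\psi$ symmetric and irreflexive on all graphs; $I(G)$ has vertex set $\{v: G\models\delta(v)\}$ and edges $uv$ ($u\ne v$ in this set) with $G\models\psi(u,v)$. $\mathcal{C}$ is interpretable in $\mathcal{D}$ if there is an interpretation $I$ with $\mathcal{C}\subseteq\{I(H):H\in\mathcal{D}\}$. Flips: flipping the edges between sets $A,B$ (with $A\cap B=\emptyset$ or $A=B$) means complementing adjacency between all pairs $u\in A$, $v\in B$, $u\ne v$. A $k$-flip of $G$ is any graph obtained by taking a partition of $V(G)$ into at most $k$ parts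 and flipping the edges between some pairs of parts (a part may be paired with itself). $\mathcal{C}$ is a perturbation of $\mathcal{D}$ if there is $k$ such that every $G\in\mathcal{C}$ is a $k$-flip of some $H\in\mathcal{D}$. Near-covered: $u,v$ are $k$-near-twins in $G$ if $|N^G(u)\,\Delta\, N^G(v)|\le k$. $G$ is $(k,m)$-near-covered if every set $S\subseteq V(G)$ whose elements are pairwise not $k$-near-twins has $|S|\le m$. A class $\mathcal{C}$ is locally almost near-covered if there are functions $k,m:\mathbb{N}\to\mathbb{N}$ such that for every $r$, every $G\in\mathcal{C}$ and every $v\in V(G)$, the induced subgraph $G[N_r^G(v)]$ is $(k(r),m(r))$-near-covered. *)

(* Defs.v *)
From mathcomp Require Import all_boot.
Set Implicit Arguments. Unset Strict Implicit. Unset Printing Implicit Defensive.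

Record graph := Graph {
  gV :> finType;
  gadj : rel gV;
  gadj_sym : symmetric gadj;
  gadj_irr : irreflexive gadj }.

Record cgraph := CGraph {
  cg :> graph;
  col : nat -> pred cg }.

Definition gclass := graph -> Prop.
Definition cgclass := cgraph -> Prop.

Definition iso (G H : graph) : Prop :=
  exists f : G -> H, bijective f /\ forall x y, gadj x y = gadj (f x) (f y).

Definition nbh (G : graph) (v : G) : {set G} := [set u | gadj v u].

Definition ball (G : graph) (r : nat) (v : G) : {set G} :=
  iter r (fun S : {set G} => S :|: [set y | [exists x in S, gadj x y]]) [set v].

Section Induced.
Variables (G : graph) (S : {set G}).
Definition ind_V : finType := {x : G | x \in S}.
Definition ind_adj : rel ind_V := fun x y => gadj (val x) (val y).
Lemma ind_adj_sym : symmetric ind_adj.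
Proof. by move=> x y; rewrite /ind_adj gadj_sym. Qed.
Lemma ind_adj_irr : irreflexive ind_adj.
Proof. by move=> x; rewrite /ind_adj gadj_irr. Qed.
Definition induced : graph := Graph ind_adj_sym ind_adj_irr.
End Induced.

(* T_{2,m}: root None, children Some (i, None), grandchildren Some (i, Some j) *)
Definition T2V (m : nat) : finType := option ('I_m * option 'I_m).
Definition T2adj (m : nat) : rel (T2V m) := fun a b =>
  match a, b with
  | None, Some (_, None) => true
  | Some (_, None), None => true
  | Some (i, None), Some (i', Some _) => i == i'
  | Some (i, Some _), Some (i', None) => i == i'
  | _, _ => false
  end.
Lemma T2adj_sym (m : nat) : symmetric (@T2adj m).
Proof. by case=> [[i [j|]]|] [[i' [j'|]]|] //=; rewrite eq_sym. Qed.
Lemma T2adj_irr (m : nat) : irreflexive (@T2adj m).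
Proof. by case=> [[i [j|]]|]. Qed.
Definition T2 (m : nat) : graph := Graph (@T2adj_sym m) (@T2adj_irr m).

(* H is an r-shallow topological minor of G: G has a subgraph isomorphic to a
   subdivision of H in which every edge is replaced by a path with at most r
   internal vertices, the paths being internally disjoint.  f maps branch
   vertices, P u v lists the internal vertices of the path for the edge uv. *)
Definition shallow_top_minor (r : nat) (H G : graph) : Prop :=
  exists (f : H -> G) (P : H -> H -> seq G),
    injective f /\
    (forall u v, gadj u v ->
       [/\ size (P u v) <= r,
           path (@gadj G) (f u) (rcons (P u v) (f v)),
           uniq (f u :: rcons (P u v) (f v)) &
           forall w, w \in P u v -> w \notin codom f]) /\
    (forall u v u' v', gadj u v -> gadj u' v' ->
       ~~ (((u == u') && (v == v')) || ((u == v') && (v == u'))) ->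
       [disjoint P u v & P u' v']).

Definition tree_rank_le2 (D : cgclass) : Prop :=
  forall r : nat, exists m : nat,
    forall H : cgraph, D H -> ~ shallow_top_minor r (T2 m) H.

Inductive formula : Type :=
  | FEq  : nat -> nat -> formula
  | FAdj : nat -> nat -> formula
  | FCol : nat -> nat -> formula          (* FCol c x : x has color c *)
  | FNot : formula -> formula
  | FAnd : formula -> formula -> formula
  | FOr  : formula -> formula -> formula
  | FEx  : nat -> formula -> formula.

Fixpoint fv (phi : formula) : seq nat :=
  match phi with
  | FEq x y | FAdj x y => [:: x; y]
  | FCol _ x => [:: x]
  | FNot f => fv f
  | FAnd f g | FOr f g => fv f ++ fv g
  | FEx x f => [seq y <- fv f | y != x]
  end.

Definition upd (T : Type) (e : nat -> T) (n : nat) (v : T) : nat -> T :=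
  fun k => if k == n then v else e k.

Fixpoint sat (G : cgraph) (phi : formula) (e : nat -> G) : bool :=
  match phi with
  | FEq x y => e x == e y
  | FAdj x y => gadj (e x) (e y)
  | FCol c x => col c (e x)
  | FNot f => ~~ sat f e
  | FAnd f g => sat f e && sat g e
  | FOr f g => sat f e || sat g e
  | FEx x f => [exists v : G, sat f (upd e x v)]
  end.

(* assignments x_0 := u, x_1 := v (other variables are never free below) *)
Definition env2 (G : cgraph) (u v : G) : nat -> G :=
  fun k => if k == 0 then u else v.
Definition env1 (G : cgraph) (u : G) : nat -> G := fun _ => u.

Record interpretation := Interp {
  ipsi : formula;
  idelta : formula;
  ipsi_fv : all (fun x => x < 2) (fv ipsi);
  idelta_fv : all (fun x => x < 1) (fv idelta);
  ipsi_sym : forall (G : cgraph) (u v : G),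
      sat ipsi (env2 u v) = sat ipsi (env2 v u);
  ipsi_irr : forall (G : cgraph) (u : G), ~~ sat ipsi (env2 u u) }.

Section Interp.
Variables (I : interpretation) (G : cgraph).
Definition interp_V : finType := {v : G | sat (idelta I) (env1 v)}.
Definition interp_adj : rel interp_V :=
  fun u v => (u != v) && sat (ipsi I) (env2 (val u) (val v)).
Lemma interp_adj_sym : symmetric interp_adj.
Proof. by move=> u v; rewrite /interp_adj eq_sym ipsi_sym. Qed.
Lemma interp_adj_irr : irreflexive interp_adj.
Proof. by move=> u; rewrite /interp_adj eqxx. Qed.
Definition interp_graph : graph := Graph interp_adj_sym interp_adj_irr.
End Interp.

Definition interpretable (C : gclass) (D : cgclass) : Prop :=
  exists I : interpretation,
    forall G : graph, C G -> exists H : cgraph, D H /\ iso G (interp_graph I H).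

(* flip of H along partition p into (at most) k parts, flipping the edges
   between the (unordered, possibly equal) pairs of parts {a,b} with F a b *)
Section Flip.
Variables (k : nat) (H : graph) (p : H -> 'I_k) (F : rel 'I_k)
          (Fsym : symmetric F).
Definition flip_adj : rel H :=
  fun u v => (u != v) && (gadj u v (+) F (p u) (p v)).
Lemma flip_adj_sym : symmetric flip_adj.
Proof. by move=> u v; rewrite /flip_adj eq_sym gadj_sym Fsym. Qed.
Lemma flip_adj_irr : irreflexive flip_adj.
Proof. by move=> u; rewrite /flip_adj eqxx. Qed.
Definition flip_graph : graph := Graph flip_adj_sym flip_adj_irr.
End Flip.

Definition is_kflip (k : nat) (G H : graph) : Prop :=
  exists (p : H -> 'I_k) (F : rel 'I_k) (Fsym : symmetric F),
    iso G (flip_graph p Fsym).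

Definition perturbation (C D : gclass) : Prop :=
  exists k : nat, forall G : graph, C G -> exists H : graph, D H /\ is_kflip k G H.

Definition near_twins (G : graph) (k : nat) (u v : G) : bool :=
  #|(nbh u :\: nbh v) :|: (nbh v :\: nbh u)| <= k.

Definition near_covered (G : graph) (k m : nat) : Prop :=
  forall S : {set G},
    {in S &, forall u v, u != v -> ~~ near_twins k u v} -> #|S| <= m.

Definition locally_almost_near_covered (C : gclass) : Prop :=
  exists k m : nat -> nat,
    forall (r : nat) (G : graph), C G -> forall v : G,
      near_covered (induced (ball r v)) (k r) (m r).

(* Main.v *)
Require Import Defs.
From mathcomp Require Import all_boot zify.
From Stdlib Require Import IndefiniteDescription.
Set Implicit Arguments. Unset Strict Implicit. Unset Printing Implicit Defensive.

(** A class has tree rank at most 2 iff for every [r] there are [d] and [M] such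
    that each ball of radius [r] contains at most [M] vertices of degree above [d].

    From (i) to (ii): by a Gaifman-style locality argument, [psi(u,v)] on pairs at
    distance more than [s] depends only on boundedly many vertex colours, so a
    bounded flip yields a graph whose edges join vertices at distance at most [s].
    In a ball of this graph, isolate the few vertices of large degree of the host
    graph and remember their neighbourhoods by colours. The same locality
    statement for the remaining metric shows that vertices of equal colour have
    the same neighbours, up to the boundedly many vertices of two balls in a graph
    of bounded degree.

    From (ii) to (i): fix the near-twin bound [k0] for radius 4, and choose
    representatives of the vertices of degree above [k0] up to [k0]-near-twins.
    Near twins of large degree share a neighbour, so representatives are locally
    few. Each vertex of large degree is stored as a pointer to its representative
    together with at most [k0] corrections; local near-coveredness at larger radii
    bounds the number of vertices of large degree in the resulting graph. *)

(** * Balls and tree rank *)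

Lemma card_bigcup_le (I T : finType) (A : {set I}) (F : I -> {set T}) n :
  {in A, forall i, #|F i| <= n} -> #|\bigcup_(i in A) F i| <= #|A| * n.
Proof.
move=> hF; rewrite -sum_nat_const.
elim/big_rec2: _ => [|i x U /hF hi h]; first by rewrite cards0.
by apply: leq_trans (leq_card_setU _ _) _; apply: leq_add.
Qed.

(** An inclusion-maximal independent subset of [W] works, since an element unrelated to all of it
    could be added. It supplies scattered sets and near-twin representatives. *)
Lemma maximal_independent (T : finType) (R : rel T) (W : {set T}) :
  symmetric R -> reflexive R ->
  exists M : {set T}, [/\ M \subset W,
    {in M &, forall x y, x != y -> ~~ R x y} &
    {in W, forall w, exists2 x, x \in M & R w x}].
Proof.
move=> Rsym Rrefl.
pose P (A : {set T}) := (A \subset W) &&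
  [forall x in A, forall y in A, (x != y) ==> ~~ R x y].
have P0 : exists A, P A.
  by exists set0; rewrite /P sub0set; apply/forall_inP=> x; rewrite inE.
have [M /maxsetP[/andP[sMW /forall_inP indM] maxM]] := ex_maxset P0.
exists M; split=> //.
  by move=> x y xM yM nxy; have /forall_inP/(_ y yM)/implyP := indM x xM; apply.
move=> w wW; apply/exists_inP; apply: contraT => /exists_inPn hw.
have wM : w \notin M by apply: contraL (Rrefl w) => /hw.
suff /maxM : P (w |: M).
  by move/(_ (subsetUr _ _)) => eM; rewrite -eM setU11 in wM.
rewrite /P subUset sub1set wW sMW; apply/forall_inP => x /setU1P hx.
apply/forall_inP => y /setU1P hy; apply/implyP => nxy.
case: hx hy nxy => [->|xM] [->|yM]; rewrite ?eqxx //.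
- by move=> _; apply: hw.
- by move=> _; rewrite Rsym; apply: hw.
- by move=> nxy; have /forall_inP/(_ y yM)/implyP := indM x xM; apply.
Qed.

Section Balls.
Variable G : graph.
Implicit Types (u v w x y z : G) (Z : {set G}).

Lemma in_ball0 u v : (u \in ball 0 v) = (u == v).
Proof. by rewrite inE. Qed.

Lemma in_ballS r u v :
  (u \in ball r.+1 v) = (u \in ball r v) || [exists x in ball r v, gadj x u].
Proof. by rewrite /ball iterS !inE. Qed.

Lemma ball_refl r v : v \in ball r v.
Proof. by elim: r => [|r IH]; rewrite ?in_ball0 ?in_ballS ?IH. Qed.

Lemma ball_step r u v w : u \in ball r v -> gadj u w -> w \in ball r.+1 v.
Proof. by move=> hu uw; rewrite in_ballS; apply/orP; right; apply/exists_inP; exists u. Qed.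

Lemma ball_adj u v : gadj u v -> v \in ball 1 u.
Proof. exact/ball_step/ball_refl. Qed.

Lemma ball_trans s t u v w : u \in ball s v -> w \in ball t u -> w \in ball (s + t) v.
Proof.
move=> hu; elim: t w => [|t IH] w; first by rewrite in_ball0 addn0 => /eqP->.
rewrite in_ballS addnS => /orP[/IH|/exists_inP[x /IH hx xw]]; last exact: ball_step hx xw.
by rewrite in_ballS => ->.
Qed.

Lemma ball_mono s t u v : s <= t -> u \in ball s v -> u \in ball t v.
Proof. by move=> st hu; rewrite -(subnKC st); apply: ball_trans hu (ball_refl _ _). Qed.

Lemma ball_symW r u v : u \in ball r v -> v \in ball r u.
Proof.
elim: r u => [|r IH] u; first by rewrite !in_ball0 eq_sym.
rewrite in_ballS => /orP[/IH|/exists_inP[x /IH vx xu]]; first exact: ball_mono.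
by apply: (@ball_trans 1 r x) => //; apply: ball_adj; rewrite gadj_sym.
Qed.

Lemma ball_sym r u v : (u \in ball r v) = (v \in ball r u).
Proof. by apply/idP/idP; apply: ball_symW. Qed.

Lemma ball_pathP r v z :
  reflect (exists p, [/\ path (@gadj G) v p, last v p = z & size p <= r])
          (z \in ball r v).
Proof.
apply: (iffP idP) => [|[p []]].
  elim: r z => [|r IH] z; first by rewrite in_ball0 => /eqP->; exists [::].
  rewrite in_ballS => /orP[/IH[p [pp lp sp]]|].
    by exists p; split=> //; apply: ltnW.
  case/exists_inP => x /IH[p [pp lp sp]] xz; exists (rcons p z).
  by rewrite rcons_path pp lp last_rcons size_rcons.
elim: p r v => [|x p IH] r v /=; first by move=> _ -> _; apply: ball_refl.
case/andP=> vx pp lp; case: r => // r sp.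
by apply: (@ball_trans 1 r x); [apply: ball_adj | apply: IH].
Qed.

Lemma card_ball_bounded_degree d r v :
  (forall x, x \in ball r v -> #|nbh x| <= d) -> #|ball r v| <= d.+1 ^ r.
Proof.
elim: r => [|r IH] hd; first by rewrite cards1.
have hd' x : x \in ball r v -> #|nbh x| <= d by move=> hx; apply/hd/(ball_mono _ hx).
apply: (@leq_trans #|\bigcup_(x in ball r v) (x |: nbh x)|).
  apply/subset_leq_card/subsetP => y; rewrite in_ballS => /orP[hy|].
    by apply/bigcupP; exists y; rewrite ?setU11.
  by case/exists_inP => x hx xy; apply/bigcupP; exists x; rewrite // !inE xy orbT.
rewrite expnSr; apply: leq_trans (leq_mul (IH hd') (leqnn _)).
apply: card_bigcup_le => x hx; apply: leq_trans (leq_card_setU _ _) _.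
by rewrite cards1 add1n ltnS hd'.
Qed.

End Balls.

Arguments ball : simpl never.

(** * Fans of short paths and the minors [T2 m] *)

Lemma flatten_nth_inj (T : eqType) (ss : seq (seq T)) i j x :
  uniq (flatten ss) -> x \in nth [::] ss i -> x \in nth [::] ss j -> i = j.
Proof.
elim: ss i j => [|s ss IH] i j /=; first by rewrite !nth_nil.
have mem k : x \in nth [::] ss k -> x \in flatten ss.
  case: (ltnP k (size ss)) => [kl xk|kl]; last by rewrite nth_default.
  by apply/flattenP; exists (nth [::] ss k); rewrite ?mem_nth.
rewrite cat_uniq => /and3P[us /hasPn hs uss].
case: i j => [|i] [|j] //=.
- by move=> xs /mem/hs; rewrite /= xs.
- by move=> /mem/hs /= /negP.
- by move=> xi xj; congr _.+1; apply: IH xj.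
Qed.

Lemma uniq_flatten_nth (T : eqType) (ss : seq (seq T)) i :
  uniq (flatten ss) -> uniq (nth [::] ss i).
Proof.
elim: ss i => [|s ss IH] [|i] //=; rewrite cat_uniq => /and3P[] // _ _; exact: IH.
Qed.

Lemma size_flatten_le (T : Type) (ss : seq (seq T)) n :
  all (fun s => size s <= n) ss -> size (flatten ss) <= size ss * n.
Proof. by elim: ss => //= s ss IH /andP[hs /IH]; rewrite size_cat mulSn; apply: leq_add. Qed.

Section Fans.
Variable G : graph.
Implicit Types (u v w x y z : G) (Z : {set G}) (ps : seq (seq G)).

(** Paths of length at most [r] from [v] into [Z] that meet only in [v]. Each list omits the start
    [v], so a single [uniq] expresses both simplicity and disjointness. *)
Definition fan r v Z ps :=
  uniq (v :: flatten ps) /\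
  (forall p, p \in ps ->
     [/\ p != [::], path (@gadj G) v p, last v p \in Z & size p <= r]).

Lemma ball_upath r v z : z \in ball r v ->
  exists p, [/\ path (@gadj G) v p, last v p = z, size p <= r & uniq (v :: p)].
Proof.
case/ball_pathP => p [pp <- sp]; case/shortenP: pp => p' pp' up' sub.
exists p'; split=> //; apply: leq_trans sp; apply: uniq_leq_size => //.
by case/andP: up'.
Qed.

(** Greedy choice: [j] paths cover at most [j * r.+1] vertices, whose [r]-balls hold at most [B]
    elements of [Z] each. An element [z] outside all these balls is reached by a new path. *)
Lemma exists_fan Z r B j v :
  (forall u, #|Z :&: ball r u| <= B) ->
  j * r.+1 * B + 1 < #|Z :&: ball r.+1 v| ->
  exists2 ps, size ps = j & fan r.+1 v Z ps.
Proof.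
move=> hB; elim: j => [|j IH] hj; first by exists [::].
have [|ps sps [ups hps]] := IH; first by apply: leq_trans hj; rewrite ltnS leq_add2r !leq_mul.
pose U := [set u in flatten ps].
have cU : #|U| <= j * r.+1.
  rewrite cardsE; apply: leq_trans (card_size _) _.
  by rewrite -sps; apply: size_flatten_le; apply/allP=> p /hps[].
pose X := v |: \bigcup_(u in U) (Z :&: ball r u).
have : #|X| < #|Z :&: ball r.+1 v|.
  apply: leq_trans hj; apply: leq_trans (leq_card_setU _ _) _.
  rewrite cards1 addnC leq_add2r; apply: leq_trans (card_bigcup_le (n := B) _) _ => //.
  by rewrite leq_mul2r (leq_trans cU) ?orbT // leq_mul2r leqnSn orbT.
rewrite ltnNge => /negP hX.
have /subsetPn[z /setIP[zZ zb]] : ~~ (Z :&: ball r.+1 v \subset X).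
  by apply: contraTN isT => /subset_leq_card.
rewrite !inE => /norP[nzv /bigcupP hz].
have [p [pp lp sp /= /andP[vp up]]] := ball_upath zb.
have pn0 : p != [::] by case: (p) lp nzv => //= ->; rewrite eqxx.
exists (p :: ps); rewrite /= ?sps //; split.
  move: ups => /= /andP[nv uf]; rewrite mem_cat negb_or vp nv cat_uniq up uf /= andbT.
  (* If the new path met an old one in [u], its tail after [u] would have length at most [r] and put
     [z] into the excluded ball around [u]. *)
  apply/hasPn => u uf'; apply/negP => up'.
  case/splitPr: up' pp lp sp => p1 p2; rewrite cat_path last_cat /= => /and3P[_ _ pp2] lp2.
  rewrite size_cat /= addnS ltnS => sp2; apply: hz; exists u; first by rewrite inE.
  rewrite inE zZ; apply/ball_pathP; exists p2; split=> //.
  by apply: leq_trans sp2; apply: leq_addl.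
by move=> p'; rewrite inE => /predU1P[->|/hps //]; rewrite lp.
Qed.

(** Greedy again: the forbidden list [U] grows by [m] vertices per treated element, and the degree
    bound leaves room to the end. *)
Lemma pick_private_neighbours m (U zs : seq G) x0 :
  (forall z, z \in zs -> size U + size zs * m <= #|nbh z|) ->
  exists qs : seq (seq G), [/\ size qs = size zs, uniq (flatten qs),
    {in flatten qs, forall x, x \notin U} &
    forall i, i < size zs ->
      size (nth [::] qs i) = m /\ {subset nth [::] qs i <= nbh (nth x0 zs i)}].
Proof.
elim: zs U => [|z zs IH] U hz; first by exists [::].
pose q := take m (enum (nbh z :\: [set u in U])).
have sq : size q = m.
  rewrite size_take -cardE.
  have : #|nbh z| <= #|nbh z :\: [set u in U]| + size U.
    rewrite -(cardsID [set u in U]) addnC leq_add2l.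
    apply: leq_trans (subset_leq_card (subsetIr _ _)) _.
    by rewrite cardsE card_size.
  move: (hz z (mem_head _ _)); rewrite /= mulSn => h1 h2.
  have h3 : m <= #|nbh z :\: [set u in U]|.
    rewrite -(leq_add2r (size U)); apply: leq_trans h2; apply: leq_trans h1.
    by rewrite addnC leq_add2l leq_addr.
  by case: ltnP => // h4; apply/eqP; rewrite eqn_leq h4 h3.
have hq x : x \in q -> x \in nbh z /\ x \notin U.
  by move/mem_take; rewrite mem_enum !inE => /andP[].
have [|qs [sqs uqs nqs hqs]] := IH (q ++ U).
  move=> z' hz'; rewrite size_cat sq -addnA addnCA -mulSn.
  by apply: hz; rewrite inE hz' orbT.
exists (q :: qs); split=> /=; first by rewrite sqs.
- rewrite cat_uniq uqs take_uniq ?enum_uniq //= andbT.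
  by apply/hasPn => x /nqs; rewrite mem_cat => /norP[].
- move=> x; rewrite mem_cat => /orP[/hq[]//|/nqs].
  by rewrite mem_cat => /norP[].
case=> [|i] /= hi; last exact: hqs.
by split=> // x /hq[].
Qed.

(** The centre becomes the root, the path ends its children, and private neighbours of the ends the
    leaves; only edges at the root are subdivided. The degree bound accounts for [v], the [m * r]
    path vertices and the [m * m] leaves. *)
Lemma fan_T2_minor m r v Z ps :
  size ps = m -> fan r v Z ps ->
  (forall z, z \in Z -> 1 + m * r + m * m <= #|nbh z|) ->
  shallow_top_minor r (T2 m) G.
Proof.
move=> sps [/= /andP[vU uU] hps] hZ.
pose pp i := nth [::] ps i.
have ppm (i : 'I_m) : pp i \in ps by rewrite mem_nth ?sps.
pose zs := [seq last v p | p <- ps].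
have szs : size zs = m by rewrite size_map.
have zsE (i : 'I_m) : nth v zs i = last v (pp i) by rewrite (nth_map [::]) ?sps.
have [|qs [sqs uqs nqs hqs]] := @pick_private_neighbours m (v :: flatten ps) zs v.
  move=> z /mapP[p /hps[_ _ /hZ hz _]] ->; rewrite szs; apply: leq_trans hz.
  rewrite leq_add2r /= ltnS -[in X in _ <= X]sps; apply: size_flatten_le.
  by apply/allP=> p' /hps[].
pose inner i := behead (belast v (pp i)).
have belE (i : 'I_m) : belast v (pp i) = v :: inner i.
  by have [] := hps _ (ppm i); rewrite /inner; case: (pp i).
have ppE (i : 'I_m) : pp i = rcons (inner i) (last v (pp i)).
  by have := lastI v (pp i); rewrite belE /= => -[].
have pflat (i : 'I_m) x : x \in pp i -> x \in flatten ps.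
  by move=> hx; apply/flattenP; exists (pp i).
have lpp (i : 'I_m) : last v (pp i) \in pp i by rewrite {2}ppE mem_rcons mem_head.
have ipp (i : 'I_m) x : x \in inner i -> x \in pp i.
  by rewrite ppE mem_rcons inE => ->; rewrite orbT.
have upp (i : 'I_m) : uniq (pp i) := uniq_flatten_nth _ uU.
have vpp (i : 'I_m) : v \notin pp i by apply: contra vU; apply: pflat.
have lin (i : 'I_m) : last v (pp i) \notin inner i.
  by move: (upp i); rewrite ppE rcons_uniq => /andP[]; rewrite last_rcons.
have pinj (i j : 'I_m) x : x \in pp i -> x \in pp j -> i = j.
  by move=> hi hj; apply/val_inj/(flatten_nth_inj uU hi hj).
pose leaf (i j : 'I_m) := nth v (nth [::] qs i) j.
have leafm (i j : 'I_m) : leaf i j \in nth [::] qs i.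
  by have [|si _] := hqs i; rewrite ?szs // /leaf mem_nth ?si.
have leaff (i j : 'I_m) : leaf i j \notin v :: flatten ps.
  apply: nqs; apply/flattenP; exists (nth [::] qs i); last exact: leafm.
  by rewrite mem_nth // sqs szs.
have leafv (i j : 'I_m) : leaf i j != v by have /norP[] := leaff i j.
have leafp (i j i' : 'I_m) : leaf i j \notin pp i'.
  by have /norP[_] := leaff i j; apply: contra; apply: pflat.
have leafadj (i j : 'I_m) : gadj (last v (pp i)) (leaf i j).
  by have [|_ /(_ _ (leafm i j))] := hqs i; rewrite ?szs // zsE inE.
have leafinj (i j i' j' : 'I_m) : leaf i j = leaf i' j' -> (i, j) = (i', j').
  move=> e; have ei : i = i'.
    by apply/val_inj/(flatten_nth_inj uqs (leafm i j)); rewrite e leafm.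
  subst i'; congr (_, _); have [|si _] := hqs i; first by rewrite szs.
  have lt (l : 'I_m) : l < size (nth [::] qs i) by rewrite si.
  apply/val_inj/eqP; rewrite -(nth_uniq v (lt j) (lt j') (uniq_flatten_nth i uqs)).
  by rewrite -/(leaf i j) e.
pose f (a : T2V m) := match a with
  | None => v | Some (i, None) => last v (pp i) | Some (i, Some j) => leaf i j end.
pose P (a b : T2V m) := match a, b with
  | None, Some (i, None) => inner i
  | Some (i, None), None => rev (inner i)
  | _, _ => [::] end.
have icodom : forall (i : 'I_m) w, w \in inner i -> w \notin codom f.
  move=> i w wi; apply/codomP => -[[[i' [j|]]|] /= e].
  - by move: (leafp i' j i); rewrite -e ipp.
  - have ei : i = i' by apply: (pinj _ _ w); [exact: ipp | rewrite e].
    by subst i'; move: (lin i); rewrite -e wi.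
  - by move: (vpp i); rewrite -e ipp.
have sin (i : 'I_m) : size (inner i) <= r.
  have [_ _ _] := hps _ (ppm i); rewrite {1}ppE size_rcons; exact: ltnW.
have pin (i : 'I_m) : path (@gadj G) v (rcons (inner i) (last v (pp i))).
  by rewrite -ppE; have [] := hps _ (ppm i).
have uin (i : 'I_m) : uniq (v :: rcons (inner i) (last v (pp i))).
  by rewrite -ppE /= vpp upp.
exists f, P; split; last split.
- move=> [[i [j|]]|] [[i' [j'|]]|] //= e.
  + by case: (leafinj _ _ _ _ e) => -> ->.
  + by move: (leafp i j i'); rewrite e lpp.
  + by move: (leafv i j); rewrite e eqxx.
  + by move: (leafp i' j' i); rewrite -e lpp.
  + by rewrite (@pinj i i' (last v (pp i))) // e lpp.
  + by move: (vpp i); rewrite -e lpp.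
  + by move: (leafv i' j'); rewrite e eqxx.
  + by move: (vpp i'); rewrite e lpp.
- have neqadj x y : gadj x y -> (x != y).
    by apply: contraTneq => ->; rewrite gadj_irr.
  move=> [[i [j|]]|] [[i' [j'|]]|] //=.
  + move=> /eqP <-; split=> //=; rewrite ?andbT 1?gadj_sym ?leafadj //.
    by rewrite inE; apply/neqadj; rewrite gadj_sym leafadj.
  + by move=> /eqP <-; split=> //=; rewrite ?andbT ?leafadj // inE neqadj.
  + move=> _; split; rewrite ?size_rev //.
    * have := rev_path (@gadj G) v (pp i); rewrite belE rev_cons => ->.
      rewrite (@eq_path _ _ (@gadj G)); first by have [] := hps _ (ppm i).
      by move=> x y /=; rewrite gadj_sym.
    * change (uniq (last v (pp i) :: rcons (rev (inner i)) v)).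
      by rewrite -rev_cons -rev_rcons rev_uniq rcons_cons; apply: uin.
    * by move=> w; rewrite mem_rev; apply: icodom.
  + by move=> _; split; [apply: sin | apply: pin | apply: uin | apply: icodom].
- have inP : forall a b x, x \in P a b -> exists2 i : 'I_m, x \in pp i &
      (a = None /\ b = Some (i, None)) \/ (a = Some (i, None) /\ b = None).
    move=> [[i [j|]]|] [[i' [j'|]]|] //= x; rewrite ?mem_rev => /ipp hx.
      by exists i => //; right.
    by exists i' => //; left.
  move=> a b a' b' _ _ ne; rewrite disjoint_has; apply/hasPn => x /inP[i xi ab].
  apply/negP => /inP[i' xi' ab']; have ei := pinj _ _ _ xi xi'; subst i'.
  by case: ab ab' ne => -[-> ->] [] [-> ->]; rewrite !eqxx.
Qed.

Definition high_in_ball (d r : nat) v := [set z in ball r v | d < #|nbh z|].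

(** Each value is the threshold of [exists_fan] for [m] paths, with the previous value as [B]. *)
Fixpoint fan_bound (m r : nat) : nat :=
  if r is r'.+1 then m * r'.+1 * fan_bound m r' + 1 else 1.

(** Induction on the radius: if the smaller balls obey the bound and a ball exceeds it, its centre
    carries a fan, which [fan_T2_minor] turns into the forbidden minor. *)
Lemma few_high_in_ball m r v :
  ~ shallow_top_minor r (T2 m) G ->
  #|high_in_ball (m * r + m * m) r v| <= fan_bound m r.
Proof.
move=> noT; pose Z := [set z : G | m * r + m * m < #|nbh z|].
suff h t u : t <= r -> #|Z :&: ball t u| <= fan_bound m t.
  by have := h r v (leqnn _); rewrite /high_in_ball setIdE setIC.
elim: t u => [|t IH] u tr.
  by apply: leq_trans (subset_leq_card (subsetIr _ _)) _; rewrite cards1.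
rewrite leqNgt; apply/negP => /exists_fan[|ps sps [h1 h2]].
  by move=> w; apply: IH; apply: ltnW.
apply: noT; apply: (@fan_T2_minor m r u Z ps) => //.
  by split=> // p /h2[h3 h4 h5 h6]; split=> //; apply: leq_trans tr.
by move=> z; rewrite inE.
Qed.

End Fans.

(** * Local types *)

Section LocalTypes.
Variable N : nat.

Definition atomic_type (X : finType) : finType :=
  ({ffun 'I_N -> option X} * {ffun 'I_N * 'I_N -> bool * bool})%type.

(** Types live in a finite type that does not mention the structure, so the number of colours built
    from them is uniform over all graphs. *)
Fixpoint ltype (X : finType) (n : nat) : finType :=
  if n is n'.+1 then (ltype X n' * {set ltype X n'})%type else atomic_type X.

Section OneStructure.
Variables (V : finType) (nr : nat -> rel V).
Implicit Types (e : nat -> option V) (I : pred nat) (a b c d : V).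

Definition orel (R : rel V) (x y : option V) : bool :=
  if x is Some a then if y is Some b then R a b else false else false.

Definition atp (X : finType) (chi : V -> X) e : atomic_type X :=
  ([ffun i : 'I_N => omap chi (e i)],
   [ffun ij : 'I_N * 'I_N => (orel eq_op (e ij.1) (e ij.2), orel (nr 1) (e ij.1) (e ij.2))]).

Definition near r e : {set V} :=
  [set c | [exists i : 'I_N, if e i is Some a then nr r a c else false]].

(* Local game types of rank [n]: the [i]-th variable is [e i], the next move is
   stored at position [k], and with [n'.+1] moves left it must stay within
   [5 * 6 ^ n'] of the elements already placed. *)
Fixpoint ltp (X : finType) (chi : V -> X) (n k : nat) e : ltype X n :=
  match n return ltype X n with
  | 0 => atp chi e
  | n'.+1 => (ltp chi n' k.+1 e,
      [set ltp chi n' k.+1 (upd e k (Some c)) | c in near (5 * 6 ^ n') e])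
  end.

Definition restr I e : nat -> option V := fun i => if I i then e i else None.

Definition single k c : nat -> option V := upd (fun _ => None) k (Some c).

Definition fresh k e := forall i, k <= i -> e i = None.

Lemma orel_restr R I e i j :
  orel R (restr I e i) (restr I e j) = I i && I j && orel R (e i) (e j).
Proof. by rewrite /restr; case: (I i); case: (I j) => //=; case: (e i). Qed.


Hypothesis nrxx : forall t a, nr t a a.
Hypothesis nrC : forall t, symmetric (nr t).
Hypothesis nrD : forall s t a b c, nr s a b -> nr t b c -> nr (s + t) a c.

Lemma nr_mono s t a b : s <= t -> nr s a b -> nr t a b.
Proof. by move=> st ab; rewrite -(subnKC st); apply: nrD ab (nrxx _ _). Qed.

Section OneColouring.
Variables (X : finType) (chi : V -> X).
Local Notation ltp := (ltp chi).

Lemma nearP r e c :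
  reflect (exists i a, [/\ i < N, e i = Some a & nr r a c]) (c \in near r e).
Proof.
rewrite inE; apply: (iffP existsP) => [[i]|[i [a [iN ei ac]]]].
  by case ei: (e i) => [a|] // ac; exists i, a.
by exists (Ordinal iN); rewrite /= ei.
Qed.

Lemma eq_ltp n k e e' : e =1 e' -> ltp n k e = ltp n k e'.
Proof.
elim: n k e e' => [|n IH] k e e' ee' /=.
  by congr pair; apply/ffunP => x; rewrite !ffunE !ee'.
congr pair; first exact: IH.
have -> : near (5 * 6 ^ n) e = near (5 * 6 ^ n) e'.
  by apply/setP => c; rewrite !inE; apply: eq_existsb => i; rewrite ee'.
apply: eq_imset => c; apply: IH => i; rewrite /upd; case: eqP => // _; exact: ee'.
Qed.

Lemma ltp_atp n k e e' : ltp n k e = ltp n k e' -> atp chi e = atp chi e'.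
Proof. by elim: n k => [|n IH] k //= [/IH]. Qed.

Lemma atp_colour e e' i : atp chi e = atp chi e' -> i < N ->
  omap chi (e i) = omap chi (e' i).
Proof. by move=> [/ffunP h _] iN; have := h (Ordinal iN); rewrite !ffunE. Qed.

Lemma atp_orel e e' i j : atp chi e = atp chi e' -> i < N -> j < N ->
  orel eq_op (e i) (e j) = orel eq_op (e' i) (e' j) /\
  orel (nr 1) (e i) (e j) = orel (nr 1) (e' i) (e' j).
Proof.
move=> [_ /ffunP h] iN jN; have := h (Ordinal iN, Ordinal jN).
by rewrite !ffunE => -[].
Qed.

Definition separated s I e := forall i j a b,
  I i -> ~~ I j -> e i = Some a -> e j = Some b -> ~~ nr s a b.

Lemma separatedC s I e : separated s I e -> separated s (predC I) e.
Proof.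
move=> h i j a b /= ni; rewrite negbK => Ij ei ej; rewrite nrC; exact: h ej ei.
Qed.

Lemma separated_orel s I e i j (R : rel V) : (forall a b, R a b -> nr s a b) ->
  separated s I e -> I i != I j -> orel R (e i) (e j) = false.
Proof.
move=> hR h; case ei: (e i) => [a|] //; case ej: (e j) => [b|] //= nij.
apply/negbTE; apply: (contra (hR a b)).
case Ii: (I i) nij; case Ij: (I j) => //= _; first by apply: h ei ej => //; rewrite Ij.
by rewrite nrC; apply: h ej ei => //; rewrite Ii.
Qed.

(* A move near one side of the split stays far from the other one, because
   [6 ^ n.+1 = 5 * 6 ^ n + 6 ^ n]. *)
Lemma ltp_merge n k I e e' :
  fresh k e -> fresh k e' -> separated (6 ^ n) I e -> separated (6 ^ n) I e' ->
  ltp n k (restr I e) = ltp n k (restr I e') ->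
  ltp n k (restr (predC I) e) = ltp n k (restr (predC I) e') ->
  ltp n k e = ltp n k e'.
Proof.
elim: n k I e e' => [|n IH] k I e e' fe fe' se se'.
  move=> /= h1 h2; rewrite /atp.
  congr pair; [apply/ffunP => i | apply/ffunP => -[i j]]; rewrite !ffunE /=.
    have := atp_colour h1 (ltn_ord i); have := atp_colour h2 (ltn_ord i).
    by rewrite /restr /=; case: (I i).
  have [t1 t2] := atp_orel h1 (ltn_ord i) (ltn_ord j).
  have [t3 t4] := atp_orel h2 (ltn_ord i) (ltn_ord j).
  move: t1 t2 t3 t4; rewrite !orel_restr /=.
  case: (boolP (I i == I j)) => [/eqP <-|nij _ _ _ _].
    by case: (I i) => /=; [move=> -> -> | move=> _ _ -> ->].
  have eqnr a b : a == b -> nr (6 ^ 0) a b by move/eqP->.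
  by rewrite !(separated_orel (s := 6 ^ 0) (I := I)).
have sepW J f : separated (6 ^ n.+1) J f -> separated (6 ^ n) J f.
  move=> h i j a b Ji Jj fi fj; apply: contra (h _ _ _ _ Ji Jj fi fj).
  by apply: nr_mono; rewrite leq_exp2l.
(* A move near the side [J] joins [J], and the induction hypothesis applies to the enlarged split.
   Moves near the other side are covered by taking [predC I] for [J]. *)
have half J f f' : fresh k f -> fresh k f' ->
    separated (6 ^ n.+1) J f -> separated (6 ^ n.+1) J f' ->
    ltp n.+1 k (restr J f) = ltp n.+1 k (restr J f') ->
    ltp n.+1 k (restr (predC J) f) = ltp n.+1 k (restr (predC J) f') ->
    forall c i a, i < N -> J i -> f i = Some a -> nr (5 * 6 ^ n) a c ->
    exists2 d, d \in near (5 * 6 ^ n) f' &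
      ltp n k.+1 (upd f k (Some c)) = ltp n k.+1 (upd f' k (Some d)).
  move=> ff ff' sf sf' /= [_ h] [h2 _] c i a iN Ji fi ac.
  have : ltp n k.+1 (upd (restr J f) k (Some c)) \in
      [set ltp n k.+1 (upd (restr J f) k (Some x)) | x in near (5 * 6 ^ n) (restr J f)].
    by apply: imset_f; apply/nearP; exists i, a; rewrite /restr Ji.
  rewrite h => /imsetP[d /nearP[j [b [jN]]]].
  rewrite {1}/restr; case Jj: (J j) => // fj bd e1.
  exists d; first by apply/nearP; exists j, b.
  pose J' := fun x => (x == k) || J x.
  have r1 g x : restr J' (upd g k (Some x)) =1 upd (restr J g) k (Some x).
    by move=> y; rewrite /restr /J' /upd; case: eqP.
  have r2 g x : fresh k g -> restr (predC J') (upd g k (Some x)) =1 restr (predC J) g.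
    move=> fg y; rewrite /restr /J' /upd /=; case: eqP => //= ->.
    by rewrite fg ?if_same.
  have s1 g x y l : separated (6 ^ n.+1) J g -> J l -> g l = Some y ->
      nr (5 * 6 ^ n) y x -> separated (6 ^ n) J' (upd g k (Some x)).
    move=> sg Jl gl yx p q u w; rewrite /J' /upd negb_or.
    case: (eqVneq q k) => //= _.
    case: (eqVneq p k) => /= _ Jp Jq; last exact: (sepW _ _ sg).
    move=> [<-] gq; apply: contra (sg _ _ _ _ Jl Jq gl gq) => xw.
    rewrite expnS (_ : 6 * 6 ^ n = 5 * 6 ^ n + 6 ^ n); last by rewrite mulSn addnC.
    exact: nrD yx xw.
  have f1 g x : fresh k g -> fresh k.+1 (upd g k (Some x)).
    by move=> fg y ky; rewrite /upd gtn_eqF // fg // ltnW.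
  apply: (IH _ J').
  - exact: f1.
  - exact: f1.
  - exact: s1 sf Ji fi ac.
  - exact: s1 sf' Jj fj bd.
  - by rewrite !(eq_ltp _ _ (r1 _ _)).
  - by rewrite (eq_ltp _ _ (r2 _ _ ff)) (eq_ltp _ _ (r2 _ _ ff')).
have restrCC J f : restr (predC (predC J)) f =1 restr J f.
  by move=> y; rewrite /restr /= negbK.
have incl f f' : fresh k f -> fresh k f' ->
    separated (6 ^ n.+1) I f -> separated (6 ^ n.+1) I f' ->
    ltp n.+1 k (restr I f) = ltp n.+1 k (restr I f') ->
    ltp n.+1 k (restr (predC I) f) = ltp n.+1 k (restr (predC I) f') ->
    [set ltp n k.+1 (upd f k (Some c)) | c in near (5 * 6 ^ n) f] \subset
    [set ltp n k.+1 (upd f' k (Some c)) | c in near (5 * 6 ^ n) f'].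
  move=> ff ff' sf sf' h1 h2; apply/subsetP => _ /imsetP[c /nearP[i [a [iN fi ac]]] ->].
  suff [d hd ->] : exists2 d, d \in near (5 * 6 ^ n) f' &
      ltp n k.+1 (upd f k (Some c)) = ltp n k.+1 (upd f' k (Some d)) by apply: imset_f.
  case: (boolP (I i)) => Ii; first exact: half h1 h2 _ _ _ iN Ii fi ac.
  apply: (half (predC I)) iN Ii fi ac => //; try exact: separatedC.
  by rewrite !(eq_ltp _ _ (restrCC _ _)).
move=> h1 h2; rewrite /=; congr pair; last first.
  by apply/eqP; rewrite eqEsubset !incl.
case: h1 h2 => h1 _ [h2 _].
by apply: (IH _ I) => //; try (exact: sepW); move=> y ky; [apply: fe | apply: fe']; apply: ltnW.
Qed.

End OneColouring.

Lemma ltp_refine (X X' : finType) (chi : V -> X) (chi' : V -> X') (f : X' -> X) n k e e' :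
  (forall v, chi v = f (chi' v)) ->
  ltp chi' n k e = ltp chi' n k e' -> ltp chi n k e = ltp chi n k e'.
Proof.
move=> hf; elim: n k e e' => [|n IH] k e e' /= h.
  rewrite /atp; congr pair; last by case: h.
  apply/ffunP => i; rewrite !ffunE; have := atp_colour h (ltn_ord i).
  have omapE x : omap chi x = omap f (omap chi' x) by case: x => //= v; rewrite hf.
  by rewrite !omapE => ->.
case: h => h1 h2; congr pair; first exact: IH.
have incl g g' : [set ltp chi' n k.+1 (upd g k (Some c)) | c in near (5 * 6 ^ n) g] =
    [set ltp chi' n k.+1 (upd g' k (Some c)) | c in near (5 * 6 ^ n) g'] ->
    [set ltp chi n k.+1 (upd g k (Some c)) | c in near (5 * 6 ^ n) g] \subset
    [set ltp chi n k.+1 (upd g' k (Some c)) | c in near (5 * 6 ^ n) g'].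
  move=> hg; apply/subsetP => _ /imsetP[c hc ->].
  have := imset_f (fun c => ltp chi' n k.+1 (upd g k (Some c))) hc.
  by rewrite hg => /imsetP[d hd /IH->]; apply: imset_f.
by apply/eqP; rewrite eqEsubset !incl.
Qed.

Definition refined (X : finType) q : finType :=
  (X * {ffun 'I_N * ltype X q -> {ffun 'I_N -> bool}})%type.

(* Replies to a far move [c] of local type [t]. If a maximal [2 * 6 ^ q]-scattered
   set of elements of type [t] is large, one of its members is far from [e'].
   Otherwise [chi'] records which elements are close to each of its members;
   as [c] is close to one of them, and [e], [e'] agree on [chi'], [c] is far
   from [e'] too and is its own reply. *)
Lemma ltp_forth (X : finType) (chi : V -> X) q :
  exists chi' : V -> refined X q, (forall v, chi v = (chi' v).1) /\
    forall k e e' c, k < N -> fresh k e -> fresh k e' ->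
      ltp chi' q.+1 k e = ltp chi' q.+1 k e' ->
      exists d, ltp chi q k.+1 (upd e k (Some c)) = ltp chi q k.+1 (upd e' k (Some d)).
Proof.
pose s := 6 ^ q.
pose ofty (kt : 'I_N * ltype X q) := [set x | ltp chi q kt.1.+1 (single kt.1 x) == kt.2].
have /fin_all_exists[scat scatP] kt :=
  maximal_independent (ofty kt) (nrC (s + s)) (nrxx (s + s)).
pose near_scat v kt (j : 'I_N) :=
  [exists x in scat kt, (index x (enum (scat kt)) == j) && nr (s + (s + s)) v x].
pose chi' v : refined X q := (chi v, [ffun kt => [ffun j => near_scat v kt j]]).
exists chi'; split=> // k e e' c kN fe fe' hee'.
have hchi v : chi v = fst (chi' v) by [].
have hlt : ltp chi q k.+1 e = ltp chi q k.+1 e'.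
  by case: hee' => h _; apply: ltp_refine hchi h.
case: (boolP (c \in near (5 * s) e)) => [hc|far].
  case: hee' => _ h.
  have := imset_f (fun c => ltp chi' q k.+1 (upd e k (Some c))) hc.
  by rewrite h => /imsetP[d _ hd]; exists d; apply: ltp_refine hchi hd.
pose kt := (Ordinal kN, ltp chi q k.+1 (single k c)).
have [sub indep cover] := scatP kt.
suff [d hd dfar] : exists2 d, ltp chi q k.+1 (single k d) = ltp chi q k.+1 (single k c) &
    d \notin near s e'.
  exists d.
  have r1 g x : restr (pred1 k) (upd g k (Some x)) =1 single k x.
    by move=> y; rewrite /restr /single /upd /=; case: eqP.
  have r2 g x : fresh k g -> restr (predC (pred1 k)) (upd g k (Some x)) =1 g.
    by move=> fg y; rewrite /restr /upd /=; case: eqP => //= ->; rewrite fg.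
  have f1 g x : fresh k g -> fresh k.+1 (upd g k (Some x)).
    by move=> fg y ky; rewrite /upd gtn_eqF // fg // ltnW.
  have s1 g x : fresh k g -> x \notin near s g -> separated s (pred1 k) (upd g k (Some x)).
    move=> fg xg i j a b /= /eqP -> jk; rewrite /upd eqxx (negbTE jk) => -[<-] gj.
    rewrite nrC; apply: contra xg => bx; apply/nearP; exists j, b; split=> //.
    by apply: (ltn_trans _ kN); rewrite ltnNge; apply/negP => /fg; rewrite gj.
  apply: (ltp_merge (I := pred1 k)); try exact: f1; try apply: s1 => //.
  - apply: contra far => /nearP[i [a [iN ei ac]]]; apply/nearP; exists i, a; split=> //.
    by apply: nr_mono ac; rewrite leq_pmull.
  - by rewrite !(eq_ltp _ _ _ (r1 _ _)).
  - by rewrite (eq_ltp _ _ _ (r2 _ _ fe)) (eq_ltp _ _ _ (r2 _ _ fe')).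
case: (leqP #|scat kt| N) => [small|big].
  exists c => //; apply/nearP => -[i [b [iN ei bc]]].
  have [|x xs cx] := cover c; first by rewrite inE.
  have jN : index x (enum (scat kt)) < N.
    by apply: leq_trans small; rewrite cardE index_mem mem_enum.
  have bx : near_scat b kt (Ordinal jN).
    by apply/exists_inP; exists x; rewrite // eqxx; apply: nrD bc cx.
  have := atp_colour (ltp_atp hee') iN; rewrite ei; case ea: (e i) => [a|] //= [_].
  move/ffunP/(_ kt); rewrite !ffunE => /ffunP/(_ (Ordinal jN)); rewrite !ffunE bx.
  case/exists_inP => y ys /andP[/eqP /= ixy ay].
  have exy : y = x.
    have [xe ye] : x \in enum (scat kt) /\ y \in enum (scat kt) by rewrite !mem_enum.
    by rewrite -(nth_index x ye) ixy nth_index.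
  (* [c] is within [2 * s] of [x], and [x] within [3 * s] of [a]; this is where the radius [5 * s]
     of near moves comes from. *)
  subst y; case/negP: far; apply/nearP; exists i, a; split=> //.
  rewrite (_ : 5 * s = s + (s + s) + (s + s)); last by lia.
  by apply: nrD ay _; rewrite nrC.
suff /subsetPn[d ds dn] : ~~ (scat kt \subset near s e').
  by exists d => //; have := subsetP sub d ds; rewrite inE => /eqP.
apply/negP => scn; move: big; rewrite ltnNge => /negP; apply.
(* Each placed element is within [s] of at most one member of the [2 * s]-scattered set. *)
pose B (i : 'I_N) := [set d in scat kt | if e' i is Some a then nr s a d else false].
apply: (@leq_trans #|\bigcup_(i in [set: 'I_N]) B i|).
  apply/subset_leq_card/subsetP => d ds; have := subsetP scn d ds; rewrite inE.
  by case/existsP => i hi; apply/bigcupP; exists i; rewrite ?inE ?ds.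
apply: leq_trans (card_bigcup_le (n := 1) _) _; last by rewrite cardsT card_ord muln1.
move=> i _; apply/card_le1_eqP => x y; rewrite !inE.
case: (e' i) => [a|]; rewrite ?andbF // => /andP[xs ax] /andP[ys ay].
case: (eqVneq x y) => [->//|nxy]; case/negP: (indep x y xs ys nxy).
by apply: nrD ay; rewrite nrC.
Qed.

End OneStructure.
End LocalTypes.


(** * From local types to truth of formulas *)

Fixpoint qrank (phi : formula) : nat :=
  match phi with
  | FNot f => qrank f
  | FAnd f g | FOr f g => maxn (qrank f) (qrank g)
  | FEx _ f => (qrank f).+1
  | _ => 0
  end.

Fixpoint colour_bound (phi : formula) : nat :=
  match phi with
  | FCol c _ => c.+1
  | FNot f | FEx _ f => colour_bound f
  | FAnd f g | FOr f g => maxn (colour_bound f) (colour_bound g)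
  | _ => 0
  end.

Definition metric_family (V : finType) (nr : nat -> rel V) :=
  [/\ forall t a, nr t a a, forall t, symmetric (nr t) &
      forall s t a b c, nr s a b -> nr t b c -> nr (s + t) a c].

(* [nr] need not be the metric of [H]: adjacency in [H] only has to be a function
   of the colours, equality and [nr 1]. *)
Definition determines (H : cgraph) (nr : nat -> rel H) (C : nat)
    (X : finType) (chi : H -> X) :=
  (forall a a' c, c < C -> chi a = chi a' -> col c a = col c a') /\
  (forall a b a' b', chi a = chi a' -> chi b = chi b' -> (a == b) = (a' == b') ->
     nr 1 a b = nr 1 a' b' -> gadj a b = gadj a' b').

Section SatTypes.
Variables (N C : nat).

(** [sigma x] is the position holding the value of the variable [x]. A quantifier fills the fresh
    position [k] and redirects [sigma], so placed elements are never overwritten. *)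
Definition assigns (H : cgraph) k (sigma : nat -> nat) (e : nat -> option H) (rho : nat -> H) :=
  fresh k e /\ forall x, sigma x < k /\ e (sigma x) = Some (rho x).

(** The last hypothesis settles quantified formulas; atoms are decided by the atomic type, and
    connectives follow. *)
Lemma sat_boolean (H : cgraph) (nr : nat -> rel H) (X0 : finType) (chi0 : H -> X0)
    q k sigma e e' rho rho' :
  determines nr C chi0 -> k <= N ->
  assigns k sigma e rho -> assigns k sigma e' rho' ->
  atp N nr chi0 e = atp N nr chi0 e' ->
  (forall x phi, qrank (FEx x phi) <= q -> colour_bound phi <= C ->
     sat (FEx x phi) rho = sat (FEx x phi) rho') ->
  forall phi, qrank phi <= q -> colour_bound phi <= C -> sat phi rho = sat phi rho'.
Proof.
move=> [dcol dadj] kN [_ he] [_ he'] hat hex.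
have hc x : chi0 (rho x) = chi0 (rho' x).
  have [sx ex] := he x; have [_ ex'] := he' x.
  by have := atp_colour hat (leq_trans sx kN); rewrite ex ex' => -[].
have h2 x y : (rho x == rho y) = (rho' x == rho' y) /\
    nr 1 (rho x) (rho y) = nr 1 (rho' x) (rho' y).
  have [sx ex] := he x; have [_ ex'] := he' x; have [sy ey] := he y; have [_ ey'] := he' y.
  by have := atp_orel hat (leq_trans sx kN) (leq_trans sy kN); rewrite ex ex' ey ey'.
elim=> [x y|x y|c x|f IH|f IHf g IHg|f IHf g IHg|x f _] //=.
- by move=> _ _; have [] := h2 x y.
- by move=> _ _; have [e1 e2] := h2 x y; apply: dadj.
- by move=> _ cC; apply: dcol.
- by move=> hq hC; rewrite IH.
- by rewrite !geq_max => /andP[q1 q2] /andP[c1 c2]; rewrite IHf ?IHg.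
- by rewrite !geq_max => /andP[q1 q2] /andP[c1 c2]; rewrite IHf ?IHg.
- exact: hex.
Qed.

(** Each quantifier level refines the colouring once by [ltp_forth], which provides replies to far
    moves as well as near ones. [X] is fixed before [H], hence uniform. *)
Lemma sat_ltp (X0 : finType) q : exists X : finType,
  forall (H : cgraph) (nr : nat -> rel H) (chi0 : H -> X0),
  metric_family nr -> determines nr C chi0 ->
  exists chi : H -> X, (exists f : X -> X0, forall v, chi0 v = f (chi v)) /\
    forall phi k sigma e e' rho rho', qrank phi <= q -> colour_bound phi <= C ->
      k + q <= N -> assigns k sigma e rho -> assigns k sigma e' rho' ->
      ltp N nr chi q k e = ltp N nr chi q k e' -> sat phi rho = sat phi rho'.
Proof.
elim: q => [|q [X IH]].
  exists X0 => H nr chi0 _ det; exists chi0; split; first by exists id.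
  move=> phi k sigma e e' rho rho' hq hC; rewrite addn0 => kN as1 as2 hat.
  exact: (sat_boolean det kN as1 as2 hat (q := 0)).
exists (refined N X q) => H nr chi0 met det.
have [chi [[f hf] hsat]] := IH H nr chi0 met det; case: met => nrxx nrC nrD.
have [chi' [hchi' forth]] := @ltp_forth N H nr nrxx nrC nrD X chi q.
exists chi'; split; first by exists (fun x => f x.1) => v; rewrite hf hchi'.
move=> phi k sigma e e' rho rho' hq hC kqN as1 as2 hlt.
have kN : k < N by apply: leq_trans kqN; rewrite addnS ltnS leq_addr.
have hat : atp N nr chi0 e = atp N nr chi0 e'.
  apply: (@ltp_refine N H nr X0 _ chi0 chi' (fun x => f x.1) 0 0) => [v|].
    by rewrite hf hchi'.
  exact: ltp_atp hlt.
apply: (sat_boolean det (ltnW kN) as1 as2 hat) hq hC => x psi; rewrite /= ltnS => hq hC.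
have half g g' r r' : assigns k sigma g r -> assigns k sigma g' r' ->
    ltp N nr chi' q.+1 k g = ltp N nr chi' q.+1 k g' ->
    [exists v, sat psi (upd r x v)] -> [exists v, sat psi (upd r' x v)].
  move=> [fg ag] [fg' ag'] hg /existsP[c hc].
  have [d hd] := forth k g g' c kN fg fg' hg.
  apply/existsP; exists d.
  suff <- : sat psi (upd r x c) = sat psi (upd r' x d) by [].
  have as3 g1 r1 x1 : fresh k g1 -> (forall x, sigma x < k /\ g1 (sigma x) = Some (r1 x)) ->
      assigns k.+1 (upd sigma x k) (upd g1 k (Some x1)) (upd r1 x x1).
    move=> fg1 ag1; split=> [y ky|y]; first by rewrite /upd gtn_eqF // fg1 // ltnW.
    rewrite /upd; case: eqP => [_|_]; first by rewrite ltnSn eqxx.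
    by have [sy gy] := ag1 y; rewrite ltnS ltnW // ltn_eqF.
  by apply: hsat hd => //; rewrite ?addSnnS //; apply: as3.
by apply/idP/idP; [apply: half as1 as2 _ | apply: half as2 as1 _].
Qed.

End SatTypes.

(** A vertex is coloured by its local types as first and as second argument. For a far pair,
    [ltp_merge] combines the two into the type of the pair, which decides [phi]. *)
Theorem far_pairs_local (phi : formula) (X0 : finType) : exists X : finType,
  forall (H : cgraph) (nr : nat -> rel H) (chi0 : H -> X0),
  metric_family nr -> determines nr (colour_bound phi) chi0 ->
  exists chi : H -> X, forall u v u' v', chi u = chi u' -> chi v = chi v' ->
    ~~ nr (6 ^ qrank phi) u v -> ~~ nr (6 ^ qrank phi) u' v' ->
    sat phi (env2 u v) = sat phi (env2 u' v').
Proof.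
pose q := qrank phi; pose N := 2 + q.
have [X hX] := sat_ltp N (colour_bound phi) X0 q.
exists (ltype N X q * ltype N X q)%type => H nr chi0 met det.
have [chi [_ hsat]] := hX H nr chi0 met det; case: met => nrxx nrC nrD.
exists (fun u => (ltp N nr chi q 2 (single 0 u), ltp N nr chi q 2 (single 1 u))).
move=> u v u' v' [hu _] [_ hv] huv huv'.
pose e (a b : H) := upd (single 0 a) 1 (Some b).
have fr a b : fresh 2 (e a b) by case=> [|[|i]].
have as1 a b : assigns 2 (fun x => if x == 0 then 0 else 1) (e a b) (env2 a b).
  by split=> // x; rewrite /env2; case: (x == 0).
apply: (hsat _ 2 _ (e u v) (e u' v')) => //.
have r1 a b : restr (pred1 0) (e a b) =1 single 0 a by case=> [|[|i]].
have r2 a b : restr (predC (pred1 0)) (e a b) =1 single 1 b by case=> [|[|i]].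
have sp a b : ~~ nr (6 ^ q) a b -> separated nr (6 ^ q) (pred1 0) (e a b).
  move=> hab i j x y /= /eqP -> j0; rewrite {1}/e /= => -[<-].
  by case: j j0 => [|[|j]] //= _ [<-].
apply: (ltp_merge nrxx nrC nrD (I := pred1 0)) => //; try exact: sp.
  by rewrite !(@eq_ltp N H nr X chi q 2 _ _ (r1 _ _)).
by rewrite !(@eq_ltp N H nr X chi q 2 _ _ (r2 _ _)).
Qed.

(** * From interpretations to perturbations *)

Lemma in_ball1 (G : graph) (a b : G) : (b \in ball 1 a) = (a == b) || gadj a b.
Proof.
rewrite in_ballS in_ball0 eq_sym; congr (_ || _).
by apply/exists_inP/idP => [[x /set1P->]|ab] //; exists a; rewrite ?ball_refl.
Qed.

Lemma gadj_ball1 (G : graph) (a b : G) : gadj a b = (a != b) && (b \in ball 1 a).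
Proof. by rewrite in_ball1; case: eqVneq => //= ->; rewrite gadj_irr. Qed.

Lemma ball_metric (G : graph) : metric_family (fun t (a b : G) => b \in ball t a).
Proof.
split=> [t a|t a b|s t a b c]; first exact: ball_refl.
  by rewrite ball_sym.
exact: ball_trans.
Qed.

Section Isolate.
Variables (G : graph) (Z : {set G}).
(** The vertices of [Z] stay and only lose their edges, so both graphs share a vertex type and their
    balls can be compared. *)
Definition isolate_adj : rel G := fun u v => [&& u \notin Z, v \notin Z & gadj u v].
Lemma isolate_adj_sym : symmetric isolate_adj.
Proof. by move=> u v; rewrite /isolate_adj gadj_sym andbCA. Qed.
Lemma isolate_adj_irr : irreflexive isolate_adj.
Proof. by move=> u; rewrite /isolate_adj gadj_irr !andbF. Qed.
Definition isolate : graph := Graph isolate_adj_sym isolate_adj_irr.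

Lemma ball_isolate r (u v : G) : u \in ball r (v : isolate) -> u \in ball r v.
Proof.
elim: r u => [|r IH] u; first by rewrite !in_ball0.
rewrite (@in_ballS isolate) => /orP[/IH|/exists_inP[x /IH hx /and3P[_ _]]].
  exact: ball_mono.
exact: ball_step.
Qed.

Lemma card_ball_isolate d r (v : G) :
  (forall x, x \in ball r v -> x \notin Z -> #|nbh x| <= d) ->
  #|ball r (v : isolate)| <= d.+1 ^ r.
Proof.
move=> hd; apply: card_ball_bounded_degree => x hx.
case: (boolP (x \in Z)) => xZ.
  by rewrite (_ : nbh x = set0) ?cards0 //; apply/setP => y; rewrite !inE /= /isolate_adj xZ.
apply: leq_trans (hd x (ball_isolate hx) xZ); apply/subset_leq_card/subsetP => y.
by rewrite !inE => /and3P[].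
Qed.

End Isolate.

Section BaseColourings.
Variables (H : cgraph) (C : nat).

Definition colours (a : H) := [ffun c : 'I_C => col c a].

Lemma colours_eq a a' c : c < C -> colours a = colours a' -> col c a = col c a'.
Proof. by move=> cC /ffunP/(_ (Ordinal cC)); rewrite !ffunE. Qed.

Lemma colours_determines : determines (fun t (a b : H) => b \in ball t a) C colours.
Proof.
split=> [a a' c|a b a' b' _ _ e1 e2]; first exact: colours_eq.
by rewrite !gadj_ball1 e1 e2.
Qed.

Variables (Z : {set H}) (M : nat).
Hypothesis ZM : #|Z| <= M.

Definition apex (i : 'I_M) : pred H := fun z => (z \in Z) && (index z (enum Z) == i).

Definition apex_colours (a : H) :=
  (colours a, [ffun i => apex i a], [ffun i => [exists z, apex i z && gadj z a]]).

(** Edges with an end in [Z] are read off from the apex colours; all others survive in [isolate Z]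
    and are seen by its unit balls. *)
Lemma apex_colours_determines :
  determines (fun t (a b : H) => b \in ball t (a : isolate Z)) C apex_colours.
Proof.
split=> [a a' c cC [h _ _]|a b a' b' [_ ha1 ha2] [_ hb1 hb2] e1 e2]; first exact: colours_eq h.
have apexI i z z' : apex i z -> apex i z' -> z = z'.
  move=> /andP[zZ /eqP iz] /andP[zZ' /eqP iz'].
  by rewrite -mem_enum in zZ; rewrite -(nth_index z' zZ) iz -iz' nth_index ?mem_enum.
have apexZ z : z \in Z -> exists i, apex i z.
  move=> zZ; have iM : index z (enum Z) < M.
    by apply: leq_trans ZM; rewrite cardE index_mem mem_enum.
  by exists (Ordinal iM); rewrite /apex zZ eqxx.
have inZ x x' : [ffun i => apex i x] = [ffun i => apex i x'] -> x \in Z -> x = x'.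
  move=> h /apexZ[i xi]; apply: apexI (xi) _.
  by move/ffunP: h => /(_ i); rewrite !ffunE xi.
have adjZ z x x' : z \in Z -> [ffun i => [exists z, apex i z && gadj z x]] =
    [ffun i => [exists z, apex i z && gadj z x']] -> gadj z x = gadj z x'.
  move=> /apexZ[i zi] /ffunP/(_ i); rewrite !ffunE => h.
  have E y : gadj z y = [exists z, apex i z && gadj z y].
    apply/idP/existsP => [zy|[z' /andP[z'i]]]; first by exists z; rewrite zi.
    by rewrite (apexI _ _ _ zi z'i).
  by rewrite !E.
case: (boolP (a \in Z)) => aZ; first by rewrite -(inZ _ _ ha1 aZ); apply: adjZ.
case: (boolP (b \in Z)) => bZ.
  by rewrite -(inZ _ _ hb1 bZ) gadj_sym [RHS]gadj_sym; apply: adjZ.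
have aZ' : a' \notin Z by apply: contra aZ => h; rewrite -(inZ _ _ (esym ha1) h).
have bZ' : b' \notin Z by apply: contra bZ => h; rewrite -(inZ _ _ (esym hb1) h).
have E x y : x \notin Z -> y \notin Z ->
    gadj x y = (x != y) && (y \in ball 1 (x : isolate Z)).
  by move=> hx hy; rewrite -(@gadj_ball1 (isolate Z)) /= /isolate_adj hx hy.
by rewrite !E // e1 e2.
Qed.

End BaseColourings.

(** * Undoing the dense part of an interpreted graph *)

Section Unflip.
Variables (I : interpretation) (H : cgraph) (X : finType) (chi : H -> X).
Let s := 6 ^ qrank (ipsi I).
Let HI := interp_graph I H.

Definition part (u : H) : 'I_#|X| := enum_rank (chi u).

(** The flip pattern is what [psi] says on far pairs between two parts. One witnessing pair
    suffices, because under [local_colouring] all far pairs agree. *)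
Definition far_rel : rel 'I_#|X| := fun i j =>
  [exists u : H, exists v : H,
    [&& part u == i, part v == j, v \notin ball s u & sat (ipsi I) (env2 u v)]].

Lemma far_rel_sym : symmetric far_rel.
Proof.
have half i j : far_rel i j -> far_rel j i.
  case/existsP => u /existsP[v /and4P[ui vj uv h]].
  by apply/existsP; exists v; apply/existsP; exists u; rewrite ui vj ball_sym uv ipsi_sym.
by move=> i j; apply/idP/idP; apply: half.
Qed.

Definition unflip : graph := flip_graph (H := HI) (fun u => part (val u)) far_rel_sym.

Definition local_colouring := forall u v u' v', chi u = chi u' -> chi v = chi v' ->
  v \notin ball s u -> v' \notin ball s u' ->
  sat (ipsi I) (env2 u v) = sat (ipsi I) (env2 u' v').

Lemma unflipK (G : graph) : iso G HI -> is_kflip #|X| G unflip.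
Proof.
move=> [f [bf hf]]; exists (fun u => part (val u)), far_rel, far_rel_sym, f; split=> //.
move=> x y; rewrite hf /= /flip_adj /= /flip_adj /= /interp_adj.
by case: (f x != f y) => //=; rewrite -addbA addbb addbF.
Qed.

Hypothesis loc : local_colouring.

Lemma far_relE u v : v \notin ball s u ->
  far_rel (part u) (part v) = sat (ipsi I) (env2 u v).
Proof.
move=> uv; apply/idP/idP => [|h].
  case/existsP => u' /existsP[v' /and4P[/eqP/enum_rank_inj eu /eqP/enum_rank_inj ev uv']].
  by rewrite (@loc u' v' u v).
by apply/existsP; exists u; apply/existsP; exists v; rewrite !eqxx uv h.
Qed.

Lemma unflip_adj_near (x y : unflip) : gadj x y -> val y \in ball s (val x).
Proof.
apply: contraTT => far; rewrite /= /flip_adj /= /interp_adj far_relE //.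
by case: (x != y) => //=; rewrite addbb.
Qed.

Lemma ball_unflip r (x y : unflip) : y \in ball r x -> val y \in ball (s * r) (val x).
Proof.
elim: r y => [|r IH] y; first by rewrite in_ball0 => /eqP->; apply: ball_refl.
rewrite in_ballS mulnSr => /orP[/IH|/exists_inP[z /IH hz /unflip_adj_near]].
  by apply: ball_mono; apply: leq_addr.
exact: ball_trans hz.
Qed.

(* Isolating the vertices [Z] of large degree near [v] leaves a graph of bounded
   degree around [v]; pairs that are far apart there are governed by [chi']. *)
Lemma unflip_near_covered d (X' : finType) r (v : unflip)
    (Z := high_in_ball d (s * r + s) (val v)) (chi' : H -> X') :
  (forall x y z w, chi' x = chi' z -> chi' y = chi' w ->
     y \notin ball s (x : isolate Z) -> w \notin ball s (z : isolate Z) ->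
     sat (ipsi I) (env2 x y) = sat (ipsi I) (env2 z w)) ->
  near_covered (induced (ball r v)) (d.+1 ^ s + d.+1 ^ s) (#|X| * #|X'|).
Proof.
move=> loc' S hS; pose g (x : induced (ball r v)) : H := val (val x).
have ginj : injective g by apply: inj_comp val_inj val_inj.
pose f x := (chi (g x), chi' (g x)).
suff finj : {in S &, injective f}.
  by rewrite -(card_in_imset finj) -card_prod max_card.
move=> x y xS yS [e1 e2]; case: (eqVneq x y) => // /(hS x y xS yS)/negP[].
(* This ball stays within [s * r + s] of [v], the radius used for [Z], so its vertices outside [Z]
   have degree at most [d]. *)
have cB z : #|ball s (g z : isolate Z)| <= d.+1 ^ s.
  apply: card_ball_isolate => a ha; rewrite inE => /nandP.
  case=> [/negP[]|]; last by rewrite -leqNgt.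
  by apply: ball_trans ha; apply: (ball_unflip (y := val z)); apply: valP.
pose B := ball s (g x : isolate Z) :|: ball s (g y : isolate Z).
apply: (@leq_trans #|B|); last by apply: leq_trans (leq_card_setU _ _) _; apply: leq_add.
rewrite -(card_imset _ ginj); apply/subset_leq_card/subsetP => _ /imsetP[w hw ->].
apply: contraLR hw => hB; have /norP[nx ny] : ~~ ((g w \in ball s (g x : isolate Z)) ||
    (g w \in ball s (g y : isolate Z))) by rewrite -in_setU.
(* Outside both balls, [x] and [y] relate to [w] alike: for [psi] because of [chi'], for the flip
   because of [chi]. *)
suff E : gadj x w = gadj y w by rewrite !inE E andNb.
have neq z : g w \notin ball s (g z : isolate Z) -> val z != val w.
  by apply: contraNneq => zw; rewrite /g zw; apply: (@ball_refl (isolate Z)).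
rewrite /= /ind_adj /= /flip_adj /= !neq //= /interp_adj !neq //=.
rewrite (loc' _ _ (g y) (g w) e2 erefl nx ny); congr (_ (+) far_rel _ _).
by rewrite /part e1.
Qed.

End Unflip.

Lemma interpretable_perturbation (C : gclass) (D : cgclass) :
  tree_rank_le2 D -> interpretable C D ->
  exists D' : gclass, locally_almost_near_covered D' /\ perturbation C D'.
Proof.
move=> trD [I hI]; pose psi := ipsi I; pose s := 6 ^ qrank psi.
have [X hX] := far_pairs_local psi {ffun 'I_(colour_bound psi) -> bool}.
exists (fun G' => exists (H : cgraph) (chi : H -> X),
  [/\ D H, local_colouring I chi & G' = unflip I chi]); split; last first.
  exists #|X| => G /hI[H [DH GH]].
  have [chi loc] := hX H _ _ (ball_metric H) (colours_determines H _).
  exists (unflip I chi); split; last exact: unflipK.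
  by exists H, chi.
(* The bounds are found radius by radius, as the degree threshold and the colour set [X'] depend on
   [r], and are then collected by choice. *)
suff /functional_choice[km hkm] : forall r, exists km : nat * nat,
    forall G', (exists (H : cgraph) (chi : H -> X),
      [/\ D H, local_colouring I chi & G' = unflip I chi]) ->
    forall v : G', near_covered (induced (ball r v)) km.1 km.2.
  by exists (fun r => (km r).1), (fun r => (km r).2) => r G; apply: hkm.
move=> r; pose R := s * r + s; have [m hm] := trD R.
pose d := m * R + m * m; pose M := fan_bound m R.
have [X' hX'] := far_pairs_local psi
  ({ffun 'I_(colour_bound psi) -> bool} * {ffun 'I_M -> bool} * {ffun 'I_M -> bool})%type.
exists (d.+1 ^ s + d.+1 ^ s, #|X| * #|X'|) => _ [H [chi [DH loc ->]]] v.
have ZM := few_high_in_ball (val v) (hm H DH).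
have [chi' loc'] := hX' H _ _ (ball_metric (isolate (high_in_ball d R (val v))))
  (apex_colours_determines _ ZM).
exact: unflip_near_covered loc'.
Qed.

(** * Sparsifying locally almost near-covered graphs *)

Lemma exists_subset_card (T : finType) (A : {set T}) n :
  n <= #|A| -> exists2 B : {set T}, B \subset A & #|B| = n.
Proof.
move=> nA; exists [set x in take n (enum A)].
  by apply/subsetP => x; rewrite inE => /mem_take; rewrite mem_enum.
by rewrite cardsE (card_uniqP (take_uniq _ (enum_uniq _))) size_takel // -cardE.
Qed.

Section NearTwins.
Variable G : graph.
Implicit Types (u v w x y : G).

Definition nbh_diff u v := (nbh u :\: nbh v) :|: (nbh v :\: nbh u).

Lemma in_nbh_diff u v w : (w \in nbh_diff u v) = gadj u w (+) gadj v w.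
Proof. by rewrite !inE; case: (gadj u w); case: (gadj v w). Qed.

Lemma near_twinsE a u v : near_twins a u v = (#|nbh_diff u v| <= a).
Proof. by []. Qed.

Lemma near_twins_refl a : reflexive (@near_twins G a).
Proof.
move=> u; rewrite /near_twins (_ : _ :|: _ = set0) ?cards0 //.
by apply/setP => w; rewrite !inE andNb.
Qed.

Lemma near_twins_sym a : symmetric (@near_twins G a).
Proof. by move=> u v; rewrite /near_twins setUC. Qed.

Lemma near_twins_trans a b u v w :
  near_twins a u v -> near_twins b v w -> near_twins (a + b) u w.
Proof.
rewrite !near_twinsE => h1 h2; apply: leq_trans (leq_add h1 h2).
apply: leq_trans (leq_card_setU _ _).
apply/subset_leq_card/subsetP => x; rewrite in_setU !in_nbh_diff.
by case: (gadj u x); case: (gadj v x); case: (gadj w x).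
Qed.

Lemma near_twins_degree a u v : near_twins a u v -> #|nbh u| <= #|nbh v| + a.
Proof.
move=> h; rewrite -(cardsID (nbh v)); apply: leq_add.
  exact/subset_leq_card/subsetIr.
by apply: leq_trans h; apply/subset_leq_card/subsetUl.
Qed.

(** More than [a] neighbours of [u] cannot all lie in a difference of size [a], so one is shared
    with [v]. *)
Lemma near_twins_common a u v : near_twins a u v -> a < #|nbh u| -> v \in ball 2 u.
Proof.
move=> h au; have /subsetPn[w uw] : ~~ (nbh u \subset nbh_diff u v).
  by apply/negP => /subset_leq_card hc; move: (leq_trans au (leq_trans hc h)); rewrite ltnn.
rewrite in_nbh_diff; rewrite inE in uw; rewrite uw /= negbK => vw.
by apply: (@ball_trans _ 1 1 w); apply: ball_adj => //; rewrite gadj_sym.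
Qed.

End NearTwins.

Section Sparsify.
Variables (G : graph) (k m : nat -> nat).
Hypothesis local : forall r (v : G), near_covered (induced (ball r v)) (k r) (m r).
Implicit Types (u v w s t : G).

(** All neighbours of vertices in the [r]-ball lie in the ball of radius [r.+1], so near-twinship in
    [G] can be tested in that induced graph. *)
Lemma local_independent r v (A : {set G}) :
  A \subset ball r v ->
  {in A &, forall x y, x != y -> ~~ near_twins (k r.+1) x y} -> #|A| <= m r.+1.
Proof.
move=> sA hA; pose A' := [set x : induced (ball r.+1 v) | val x \in A].
have inj : injective (val : induced (ball r.+1 v) -> G) by apply: val_inj.
have up u : u \in ball r.+1 v -> exists x : induced (ball r.+1 v), val x = u.
  by move=> hu; exists (Sub u hu); rewrite SubK.
have -> : A = val @: A'.
  apply/setP => u; apply/idP/imsetP => [uA|[x]]; last by rewrite inE => hx ->.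
  have [|x ex] := up u; first by apply: ball_mono (subsetP sA u uA).
  by exists x; rewrite ?inE ex.
rewrite (card_imset _ inj); apply: local => x y; rewrite !inE => xA yA nxy.
have nval : val x != val y by apply: contra nxy => /eqP/inj->.
apply: contra (hA _ _ xA yA nval) => h; apply: leq_trans h; rewrite -(card_imset _ inj).
apply/subset_leq_card/subsetP => w hw.
have [|z ez] := up w.
  by case/setUP: hw => /setDP[zw _]; rewrite inE in zw; apply: ball_step zw; apply: (subsetP sA).
apply/imsetP; exists z => //; move: hw; rewrite -!/(nbh_diff _ _) !in_nbh_diff /=.
by rewrite /ind_adj ez.
Qed.

(** Radius 4 arises because representatives are counted in balls of radius 3 and [local_independent]
    costs one more step. *)
Local Notation k0 := (k 4).
Local Notation m0 := (m 4).

Definition high u := k0 < #|nbh u|.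

Variables (S : {set G}) (rep : G -> G).
Hypothesis S_high : {in S, forall s, high s}.
Hypothesis S_indep : {in S &, forall x y, x != y -> ~~ near_twins k0 x y}.
Hypothesis repS : forall u, high u -> rep u \in S.
Hypothesis rep_twin : forall u, high u -> near_twins k0 u (rep u).

Lemma rep_ball u : high u -> rep u \in ball 2 u.
Proof. by move=> hu; apply: near_twins_common (rep_twin hu) hu. Qed.

Lemma card_S_ball v : #|S :&: ball 3 v| <= m0.
Proof.
apply: (local_independent (subsetIr _ _)) => x y /setIP[xS _] /setIP[yS _]; exact: S_indep.
Qed.

Definition S_large r v := [set s in S :&: ball r v | k r.+1 < #|nbh s|].

Lemma in_S_large r v s :
  (s \in S_large r v) = [&& s \in S, s \in ball r v & k r.+1 < #|nbh s|].
Proof. by rewrite in_set in_setI andbA. Qed.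

(** A maximal subset without [k r.+1]-near-twins has at most [m r.+1] elements. By the degree
    condition the others share a neighbour with one of these, and each 3-ball holds at most [m0]
    representatives. *)
Lemma card_S_large r v : #|S_large r v| <= m r.+1 * m0.
Proof.
have [M [sM indM covM]] := maximal_independent (S_large r v)
  (@near_twins_sym G (k r.+1)) (@near_twins_refl G (k r.+1)).
have cM : #|M| <= m r.+1.
  apply: (local_independent (v := v) _ indM); apply: subset_trans sM _.
  by apply/subsetP => s; rewrite in_S_large => /and3P[].
apply: leq_trans (leq_mul cM (leqnn _)).
apply: leq_trans (card_bigcup_le (F := fun t => S :&: ball 3 t) (fun t _ => card_S_ball t)).
apply/subset_leq_card/subsetP => s sL; have [t tM st] := covM s sL.
apply/bigcupP; exists t => //; move: sL; rewrite in_S_large => /and3P[sS _ ks].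
by rewrite in_setI sS ball_sym; apply: ball_mono (near_twins_common st ks).
Qed.

Definition class s := [set u | high u && (rep u == s)].

Definition class_bound r := k0.+1 * (k0 + k r.+4).

Definition S_wide r v := [set s in S :&: ball r v | class_bound r < #|class s|].

Lemma in_S_wide r v s :
  (s \in S_wide r v) = [&& s \in S, s \in ball r v & class_bound r < #|class s|].
Proof. by rewrite in_set in_setI andbA. Qed.

(** Fix [k0.+1] neighbours of [s]. Each member of the class, a [k0]-near-twin of [s], sees one of
    them; a wide class thus forces a neighbour [w] of degree above [k0 + k r.+4], and [rep w] loses
    at most [k0] of it. *)
Lemma wide_large r v s : s \in S_wide r v -> exists2 t, t \in S_large r.+3 v & s \in ball 3 t.
Proof.
rewrite in_S_wide => /and3P[sS sb wide].
have [T sT cT] := exists_subset_card (S_high sS).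
have [w wT hw] : exists2 w, w \in T & k0 + k r.+4 < #|nbh w|.
  apply/exists_inP; apply: contraLR wide => /exists_inPn small.
  rewrite -leqNgt /class_bound -cT.
  have small' : {in T, forall w, #|nbh w| <= k0 + k r.+4} by move=> w /small; rewrite -leqNgt.
  apply: leq_trans (card_bigcup_le small').
  apply/subset_leq_card/subsetP => u; rewrite inE => /andP[hu /eqP us].
  have /subsetPn[w wT] : ~~ (T \subset nbh_diff u s).
    apply/negP => /subset_leq_card; rewrite cT => hc.
    by have := rep_twin hu; rewrite us near_twinsE leqNgt hc.
  have sw := subsetP sT w wT; rewrite inE in sw.
  rewrite in_nbh_diff sw addbT negbK => uw.
  by apply/bigcupP; exists w; rewrite // inE gadj_sym.
have high_w : high w by apply: leq_ltn_trans hw; apply: leq_addr.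
have sw : gadj s w by have := subsetP sT w wT; rewrite inE.
have ts : rep w \in ball 3 s by apply: (@ball_trans _ 1 2 w); [apply: ball_adj | apply: rep_ball].
exists (rep w); last by rewrite ball_sym.
have tb : rep w \in ball r.+3 v by rewrite -addn3; apply: ball_trans sb ts.
rewrite in_S_large repS // tb /= -(ltn_add2l k0) [X in _ < X]addnC.
exact: leq_trans hw (near_twins_degree (rep_twin high_w)).
Qed.

Lemma card_S_wide r v : #|S_wide r v| <= m r.+4 * m0 * m0.
Proof.
apply: leq_trans (leq_mul (card_S_large r.+3 v) (leqnn _)).
apply: leq_trans (card_bigcup_le (F := fun t => S :&: ball 3 t) (fun t _ => card_S_ball t)).
apply/subset_leq_card/subsetP => s sW; have [t tL st] := wide_large sW.
apply/bigcupP; exists t => //; rewrite in_setI st andbT.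
by move: sW; rewrite in_S_wide => /and3P[].
Qed.

Definition exc u v := gadj u v (+) gadj (rep u) v.

Lemma card_exc u : high u -> #|[set v | exc u v]| <= k0.
Proof.
move=> hu; have := rep_twin hu; rewrite near_twinsE; apply: leq_trans.
by apply/subset_leq_card/subsetP => v; rewrite in_nbh_diff inE.
Qed.

Lemma exc_ball u v : high u -> exc u v -> v \in ball 3 u /\ rep u \in ball 3 v.
Proof.
move=> hu; have ru := rep_ball hu; rewrite /exc.
case: (boolP (gadj u v)) => [uv _|_ /= rv].
  split; first exact: ball_mono (ball_adj uv).
  by apply: (@ball_trans _ 1 2 u) => //; apply: ball_adj; rewrite gadj_sym.
split; first by apply: (@ball_trans _ 2 1 (rep u)) => //; apply: ball_adj.
by rewrite gadj_sym in rv; apply: ball_mono (ball_adj rv).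
Qed.

Definition class_exc s v := [set u in class s | exc u v].

Definition S_exceptional s := [set v in ball 3 s | k0.+1 * (k0 + k0) < #|class_exc s v|].

(** Group the vertices by near-twin representative [t] and adjacency to [s]. If [k0.+1] vertices
    shared a group, their mutual differences would be too small to contain [class_exc s v0]. Some
    [u] of the class would then see them all alike, as [s] does, and need [k0.+1] corrections. *)
Lemma card_S_exceptional s : #|S_exceptional s| <= m0 * (k0 + k0).
Proof.
have [M [sM indM covM]] := maximal_independent (S_exceptional s)
  (@near_twins_sym G k0) (@near_twins_refl G k0).
have cM : #|M| <= m0.
  apply: (local_independent (v := s) _ indM); apply: subset_trans sM _.
  by apply/subsetP => v; rewrite in_set => /andP[].
pose gr (b : bool) t := [set v in S_exceptional s | near_twins k0 v t && (gadj s v == b)].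
have cgr b t : #|gr b t| <= k0.
  rewrite leqNgt; apply/negP => /exists_subset_card[A sA cA].
  have [v0 v0A] : exists v0, v0 \in A by apply/set0Pn; rewrite -card_gt0 cA.
  have Agr v : v \in A -> [/\ v \in S_exceptional s, near_twins k0 v t & gadj s v = b].
    by move/(subsetP sA); rewrite inE => /and3P[h1 h2 /eqP h3].
  have [v0S v0t v0b] := Agr _ v0A.
  have cU : #|\bigcup_(v in A) nbh_diff v0 v| <= k0.+1 * (k0 + k0).
    rewrite -cA; apply: card_bigcup_le => v /Agr[_ vt _].
    by apply: near_twins_trans v0t _; rewrite near_twins_sym.
  have /subsetPn[u uX uU] : ~~ (class_exc s v0 \subset \bigcup_(v in A) nbh_diff v0 v).
    apply/negP => /subset_leq_card hc; move: v0S; rewrite inE => /andP[_].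
    by rewrite ltnNge (leq_trans hc cU).
  move: uX; rewrite !inE => /andP[/andP[hu /eqP us] ex].
  suff : #|A| <= k0 by rewrite cA ltnn.
  apply: leq_trans (card_exc hu); apply/subset_leq_card/subsetP => v vA.
  have [_ _ vb] := Agr _ vA.
  have E : gadj u v = gadj u v0.
    apply/eqP; apply: contraNT uU => ne; apply/bigcupP; exists v => //.
    rewrite in_nbh_diff (gadj_sym v0) (gadj_sym v).
    by move: ne; case: (gadj u v); case: (gadj u v0).
  by rewrite inE /exc us E vb -v0b -us.
apply: leq_trans (leq_mul cM (leqnn _)).
apply: leq_trans (card_bigcup_le (F := fun t => gr true t :|: gr false t) _); last first.
  by move=> t _; apply: leq_trans (leq_card_setU _ _) (leq_add _ _).
apply/subset_leq_card/subsetP => v vS; have [t tM vt] := covM v vS.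
apply/bigcupP; exists t => //; rewrite in_setU; apply/orP.
by case E: (gadj s v); [left | right]; rewrite inE vS vt E.
Qed.

Definition exc_in v := [set u | high u && exc u v].

Definition exc_bound r := m0 * (class_bound r.+3 + k0.+1 * (k0 + k0)).

Definition exceptional r v := [set w in ball r v | exc_bound r < #|exc_in w|].

Definition wide_bound r := m r.+4 * m0 * m0.

(** The corrections at [w] come from classes of at most [m0] representatives near [w]. One of these
    classes contributes so many that its representative [s] is wide and [w] is exceptional for
    [s]. *)
Lemma card_exceptional r v : #|exceptional r v| <= wide_bound r.+3 * (m0 * (k0 + k0)).
Proof.
apply: leq_trans (leq_mul (card_S_wide r.+3 v) (leqnn _)).
apply: leq_trans (card_bigcup_le (F := S_exceptional) (fun s _ => card_S_exceptional s)).
apply/subset_leq_card/subsetP => w; rewrite in_set => /andP[wb we].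
pose c := class_bound r.+3 + k0.+1 * (k0 + k0).
have [s /setIP[sS sb] hs] : exists2 s, s \in S :&: ball 3 w & c < #|class_exc s w|.
  apply/exists_inP; apply: contraLR we => /exists_inPn small; rewrite -leqNgt.
  have small' : {in S :&: ball 3 w, forall s, #|class_exc s w| <= c}.
    by move=> s /small; rewrite -leqNgt.
  apply: leq_trans (leq_mul (card_S_ball w) (leqnn _)).
  apply: leq_trans (card_bigcup_le small').
  apply/subset_leq_card/subsetP => u; rewrite inE => /andP[hu ex].
  have [_ rw] := exc_ball hu ex.
  by apply/bigcupP; exists (rep u); rewrite ?in_setI ?repS ?rw // !in_set hu eqxx.
apply/bigcupP; exists s.
  have sb' : s \in ball r.+3 v by rewrite -addn3; apply: ball_trans wb sb.
  rewrite in_S_wide sS sb' /=.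
  apply: (leq_trans (n := #|class_exc s w|)); first by apply: leq_ltn_trans hs; apply: leq_addr.
  by apply/subset_leq_card/subsetP => u; rewrite inE => /andP[].
by rewrite in_set ball_sym sb; apply: leq_ltn_trans hs; apply: leq_addl.
Qed.

(* Labels: 0 joins a vertex of large degree to its representative, 1 keeps the
   neighbourhoods of representatives, and 2 holds the corrections, with the edges
   between vertices of small degree. *)
Definition sparse_rel (i : 'I_3) : rel G := fun u v =>
  match val i with
  | 0 => high u && (v == rep u)
  | 1 => (u \in S) && gadj u v
  | _ => if high u then exc u v else gadj u v && ~~ high v
  end.

Lemma sparse_rel_ball i u v : sparse_rel i u v -> v \in ball 3 u.
Proof.
rewrite /sparse_rel; case: (val i) => [|[|_]].
- by case/andP => /rep_ball hu /eqP->; apply: ball_mono hu.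
- by case/andP => _ /ball_adj; apply: ball_mono.
- case: ifP => [hu /(exc_ball hu)[]//|_ /andP[/ball_adj hv _]].
  exact: ball_mono hv.
Qed.

Definition out_deg i u := #|[set v | sparse_rel i u v]|.
Definition in_deg i u := #|[set v | sparse_rel i v u]|.
Definition sparse_deg u := \sum_i (out_deg i u + in_deg i u).

Definition sparse_deg_bound r :=
  1 + class_bound r + (k r.+1 + m0 + (k0 + (k0 + exc_bound r))).

Definition sparse_count_bound r :=
  m r.+1 * m0 + wide_bound r + wide_bound r.+3 * (m0 * (k0 + k0)).

(** Outside the three exceptional sets all six degrees are bounded: [S_wide] controls arcs of label
    0 into [u], [S_large] arcs of label 1 out of [u], and [exceptional] arcs of label 2 into [u];
    the other three are always small. *)
Lemma few_sparse_high r v :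
  #|[set u in ball r v | sparse_deg_bound r < sparse_deg u]| <= sparse_count_bound r.
Proof.
apply: (@leq_trans #|S_large r v :|: S_wide r v :|: exceptional r v|); last first.
  apply: leq_trans (leq_card_setU _ _) (leq_add _ (card_exceptional _ _)).
  by apply: leq_trans (leq_card_setU _ _) (leq_add (card_S_large _ _) (card_S_wide _ _)).
apply/subset_leq_card/subsetP => u; rewrite inE => /andP[ub].
apply: contraLR; rewrite !in_setU => /norP[/norP[nl nw] ne].
rewrite -leqNgt /sparse_deg !big_ord_recl big_ord0 addn0 /sparse_deg_bound.
have o1 : out_deg ord0 u <= 1.
  apply: (@leq_trans #|[set rep u]|); last by rewrite cards1.
  apply/subset_leq_card/subsetP => w.
  by rewrite !inE /sparse_rel /= => /andP[].
have i1 : in_deg ord0 u <= class_bound r.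
  case: (boolP (u \in S)) => uS.
    move: nw; rewrite in_S_wide uS ub /= -leqNgt; apply: leq_trans.
    by apply/subset_leq_card/subsetP => w; rewrite !inE /sparse_rel /= eq_sym.
  rewrite /in_deg (_ : [set _ | _] = set0) ?cards0 //; apply/setP => w.
  by rewrite !inE /sparse_rel /=; apply/negbTE/negP => /andP[/repS hw /eqP uw]; rewrite uw hw in uS.
pose l1 := lift ord0 (ord0 : 'I_2).
have o2 : out_deg l1 u <= k r.+1.
  case: (boolP (u \in S)) => uS.
    move: nl; rewrite in_S_large uS ub /= -leqNgt; apply: leq_trans.
    by apply/subset_leq_card/subsetP => w; rewrite !inE /sparse_rel /= => /andP[].
  rewrite /out_deg (_ : [set _ | _] = set0) ?cards0 //; apply/setP => w.
  by rewrite !inE /sparse_rel /= (negbTE uS).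
have i2 : in_deg l1 u <= m0.
  apply: leq_trans (card_S_ball u); apply/subset_leq_card/subsetP => w.
  rewrite in_set in_setI /sparse_rel /= => /andP[-> wu].
  by rewrite gadj_sym in wu; apply: ball_mono (ball_adj wu).
pose l2 := lift ord0 (lift ord0 (ord0 : 'I_1)).
have o3 : out_deg l2 u <= k0.
  rewrite /out_deg; case: (boolP (high u)) => hu.
    apply: leq_trans (card_exc hu); apply/subset_leq_card/subsetP => w.
    by rewrite !inE /sparse_rel /= hu.
  move: (hu); rewrite /high -leqNgt; apply: leq_trans.
  by apply/subset_leq_card/subsetP => w; rewrite !inE /sparse_rel /= (negbTE hu) => /andP[].
have i3 : in_deg l2 u <= k0 + exc_bound r.
  have ne' : #|exc_in u| <= exc_bound r by move: ne; rewrite inE ub /= -leqNgt.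
  case: (boolP (high u)) => hu.
    apply: leq_trans (leq_trans ne' (leq_addl _ _)); apply/subset_leq_card/subsetP => w.
    by rewrite !inE /sparse_rel /= hu; case: (high w); rewrite ?andbF.
  have lu : #|nbh u| <= k0 by rewrite leqNgt.
  apply: leq_trans (leq_add lu ne'); apply: leq_trans (leq_card_setU _ _).
  apply/subset_leq_card/subsetP => w; rewrite !inE /sparse_rel /= [gadj u w]gadj_sym.
  by case: (high w) => [->|/andP[->]]; rewrite ?orbT.
apply: leq_add; first exact: leq_add o1 i1.
exact: leq_add (leq_add o2 i2) (leq_add o3 i3).
Qed.

Definition decode u v :=
  [exists s, sparse_rel (inord 0) u s && sparse_rel (inord 1) s v] (+) sparse_rel (inord 2) u v.

(** From a vertex of large degree all edges are recovered by applying the corrections to its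
    representative; from one of small degree only edges to small degree. Mixed edges need the
    disjunction. *)
Lemma decodeE u v : decode u v || decode v u = gadj u v.
Proof.
have T x y : decode x y = gadj x y && (high x || ~~ high y).
  rewrite /decode /sparse_rel /= !inordK //; case: (boolP (high x)) => hx /=.
    have -> : [exists s, (s == rep x) && ((s \in S) && gadj s y)] = gadj (rep x) y.
      apply/existsP/idP => [[s /and3P[/eqP-> _ //]]|h].
      by exists (rep x); rewrite eqxx repS.
    by rewrite /exc addbC addbK andbT.
  have -> : [exists s : G, false] = false by apply/existsP => -[].
  by [].
rewrite !T (gadj_sym v u); case: (gadj u v) => //=.
by case: (high u); case: (high v).
Qed.

End Sparsify.

(** * Encoding flips by interpretations *)

(** The converse direction of the degree criterion: the images of the children lie within [r.+1] of
    the image of the root, and each starts [m] paths with distinct first steps. *)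
Lemma T2_minor_many_high (G : graph) m r :
  shallow_top_minor r (T2 m) G ->
  m > 0 -> exists x : G, m <= #|high_in_ball m.-1 r.+1 x|.
Proof.
move=> [f [P [finj [hP disj]]]] m0; exists (f None).
pose ch (i : 'I_m) : T2 m := Some (i, None).
have chinj : injective (fun i => f (ch i)) by move=> i j /finj[].
rewrite -[X in X <= _](card_ord m) -(card_codom chinj).
apply/subset_leq_card/subsetP => _ /codomP[i ->]; rewrite in_set; apply/andP; split.
  have [|s p _ _] := hP None (ch i); first by [].
  by apply/ball_pathP; exists (rcons (P None (ch i)) (f (ch i))); rewrite last_rcons size_rcons.
rewrite prednK //; pose lf j : T2 m := Some (i, Some j).
have adj j : gadj (ch i) (lf j) by rewrite /= eqxx.
(* The first vertex on the path to the leaf, which is the leaf itself if the edge is not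
   subdivided. *)
pose h j := head (f (lf j)) (P (ch i) (lf j)).
have hP' j : (h j \in P (ch i) (lf j)) || (h j == f (lf j)).
  by rewrite /h; case: (P _ _) => [|y s] /=; rewrite ?eqxx ?mem_head.
have cod j w : w \in P (ch i) (lf j) -> w \notin codom f by have [_ _ _] := hP _ _ (adj j); apply.
have hinj : injective h.
  move=> j j' e; case: (eqVneq j j') => // nj.
  have := hP' j; have := hP' j'; rewrite -e.
  case/orP=> [h1|/eqP h1] /orP[h2|/eqP h2].
  - have nlf : lf j != lf j' by apply: contra nj => /eqP[->].
    have : [disjoint P (ch i) (lf j) & P (ch i) (lf j')].
      by apply: disj => //; rewrite (negbTE nlf) andbF; apply/nandP; left; apply/eqP.
    by rewrite disjoint_has => /hasPn/(_ _ h2)/negP; case.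
  - by move: (cod _ _ h1); rewrite h2 codom_f.
  - by move: (cod _ _ h2); rewrite h1 codom_f.
  - by move: h1; rewrite h2 => /finj[].
rewrite -[X in X <= _](card_ord m) -(card_codom hinj).
apply/subset_leq_card/subsetP => _ /codomP[j ->]; rewrite in_set /h.
have [_ + _ _] := hP _ _ (adj j).
by case: (P _ _) => [|y s] /= /andP[].
Qed.

(** * Labelled arcs as subdivided edges *)

Section Gadget.
Variables (V L : finType) (R : L -> rel V).

(* The arc [R l a b] becomes the path a - (l,a,b,false) - (l,a,b,true) - b. *)
Definition gadget_V : finType := (V + L * V * V * bool)%type.

Definition link (u : V) (t : L * V * V * bool) : bool :=
  let: (l, a, b, x) := t in R l a b && (u == if x then b else a).

Definition gadget_adj : rel gadget_V := fun y z =>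
  match y, z with
  | inl u, inr t => link u t
  | inr t, inl u => link u t
  | inr t, inr t' => [&& t.1 == t'.1, t.2 != t'.2 & R t.1.1.1 t.1.1.2 t.1.2]
  | _, _ => false
  end.

Lemma gadget_adj_sym : symmetric gadget_adj.
Proof.
move=> [u|[[[l a] b] x]] [v|[[[l' a'] b'] x']] //=.
by rewrite (eq_sym (l, a, b)) (eq_sym x); case: eqP => //= -[-> -> ->].
Qed.

Lemma gadget_adj_irr : irreflexive gadget_adj.
Proof. by move=> [u|[[[l a] b] x]] //=; rewrite !eqxx. Qed.

Definition gadget : graph := Graph gadget_adj_sym gadget_adj_irr.

Definition base (z : gadget) : V :=
  match z with inl u => u | inr (_, a, _, _) => a end.

Lemma gadget_degree_inr t : #|nbh (inr t : gadget)| <= 2.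
Proof.
case: t => [[[l a] b] x].
apply: (@leq_trans #|[set (inl (if x then b else a) : gadget); inr (l, a, b, ~~ x)]|); last first.
  by rewrite cards2 ltnS leq_b1.
apply/subset_leq_card/subsetP => -[u|[[[l' a'] b'] x']]; rewrite in_set in_set2 /=.
  by move=> /andP[_ /eqP->]; rewrite eqxx.
by case/and3P => /eqP[-> -> ->] xx' _; apply/eqP; case: x x' xx' => -[].
Qed.

Lemma gadget_degree_inl u :
  #|nbh (inl u : gadget)| <=
  \sum_l (#|[set v | R l u v]| + #|[set v | R l v u]|).
Proof.
pose out l := [set (inr (l, u, v, false) : gadget) | v in [set v | R l u v]].
pose inn l := [set (inr (l, v, u, true) : gadget) | v in [set v | R l v u]].
apply: (@leq_trans #|\bigcup_l (out l :|: inn l)|).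
  apply/subset_leq_card/subsetP => -[v|[[[l a] b] x]]; rewrite in_set //= => /andP[ab /eqP ux].
  apply/bigcupP; exists l => //; rewrite in_setU; apply/orP.
  by case: x ux => ux; [right | left]; apply/imsetP; [exists a | exists b]; rewrite ?in_set ?ux.
elim/big_rec2: _ => [|l n A _ hA]; first by rewrite cards0.
apply: leq_trans (leq_card_setU _ _) (leq_add _ hA).
by apply: leq_trans (leq_card_setU _ _) (leq_add _ _); apply: leq_imset_card.
Qed.

End Gadget.

(** Each gadget edge moves the base vertex along at most one arc, and arcs span distance at most
    [c]. *)
Lemma base_ball (G : graph) (L : finType) (R : L -> rel G) c r (y z : gadget R) :
  (forall l a b, R l a b -> b \in ball c a) ->
  z \in ball r y -> base z \in ball (c * r) (base y).
Proof.
move=> hR; elim: r z => [|r IH] z; first by rewrite in_ball0 => /eqP->; apply: ball_refl.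
rewrite in_ballS mulnSr => /orP[/IH|/exists_inP[x /IH hx xz]].
  by apply: ball_mono; apply: leq_addr.
apply: ball_trans hx _; case: x z xz => [u|[[[l a] b] x]] [v|[[[l' a'] b'] x']] //=.
- case/andP => /hR ab /eqP->; case: x' => //; last exact: ball_refl.
  by rewrite ball_sym.
- by case/andP => /hR ab /eqP->; case: x => //; apply: ball_refl.
- by case/and3P => /eqP[_ -> _] _ _; apply: ball_refl.
Qed.

(** * The interpreting formula *)

Definition FXor f g := FOr (FAnd f (FNot g)) (FAnd (FNot f) g).

Lemma sat_xor (H : cgraph) f g (e : nat -> H) : sat (FXor f g) e = sat f e (+) sat g e.
Proof. by rewrite /=; case: (sat f e); case: (sat g e). Qed.

(* Colour 0 marks the vertices of the encoded graph, colours [2l+1] and [2l+2] the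
   two halves of the arcs labelled [l], and for a flip along parts [p] by [F],
   colour [2j+7] means [F (p u) j] and colour [2j+8] means [p u = j]. *)
Definition FArc l x y :=
  FEx 2 (FEx 3 (FAnd (FAnd (FAdj x 2) (FCol l.*2.+1 2))
    (FAnd (FAnd (FAdj 2 3) (FCol l.*2.+2 3)) (FAdj 3 y)))).

Definition marked_path (H : cgraph) l (a b : H) :=
  [exists z, exists w, (gadj a z && col l.*2.+1 z) &&
    ((gadj z w && col l.*2.+2 w) && gadj w b)].

Lemma sat_arc (H : cgraph) l x y (e : nat -> H) :
  x \notin [:: 2; 3] -> y \notin [:: 2; 3] -> sat (FArc l x y) e = marked_path l (e x) (e y).
Proof.
rewrite !inE => /norP[/negbTE x2 /negbTE x3] /norP[/negbTE y2 /negbTE y3] /=.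
apply: eq_existsb => z; apply: eq_existsb => w.
by rewrite /upd /= x2 x3 y2 y3.
Qed.

Definition FDecode x y :=
  FXor (FEx 4 (FAnd (FCol 0 4) (FAnd (FArc 0 x 4) (FArc 1 4 y)))) (FArc 2 x y).

Definition decode_sem (H : cgraph) (a b : H) :=
  [exists s : H, col 0 s && (marked_path 0 a s && marked_path 1 s b)] (+) marked_path 2 a b.

Lemma sat_decode (H : cgraph) x y (e : nat -> H) :
  x < 2 -> y < 2 -> sat (FDecode x y) e = decode_sem (e x) (e y).
Proof.
move=> hx hy; rewrite /FDecode sat_xor sat_arc /decode_sem;
  by case: x hx => [|[]] //; case: y hy => [|[]].
Qed.

(** The flip relation varies with the graph and is therefore read from colours; the formula depends
    on [k] alone. The base case is a contradiction. *)
Fixpoint FFlip k x y :=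
  if k is k'.+1 then FOr (FAnd (FCol (k'.*2 + 7) x) (FCol (k'.*2 + 8) y)) (FFlip k' x y)
  else FNot (FEq x x).

Definition flip_sem (H : cgraph) k (a b : H) :=
  has (fun j => col (j.*2 + 7) a && col (j.*2 + 8) b) (iota 0 k).

Lemma sat_flip (H : cgraph) k x y (e : nat -> H) :
  sat (FFlip k x y) e = flip_sem k (e x) (e y).
Proof.
rewrite /flip_sem; elim: k => [|k IH]; first by rewrite /= eqxx.
by rewrite -addn1 iotaD has_cat /= orbF addn1 /= IH orbC.
Qed.

Lemma fv_flip k :
  all (fun x => x < 2) (fv (FFlip k 0 1)) /\ all (fun x => x < 2) (fv (FFlip k 1 0)).
Proof. by elim: k => [|k [IH1 IH2]] //=; rewrite IH1 IH2. Qed.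

Definition FEdge k x y := FXor (FOr (FDecode x y) (FDecode y x)) (FFlip k x y).

Definition edge_sem (H : cgraph) k (a b : H) :=
  (decode_sem a b || decode_sem b a) (+) flip_sem k a b.

(** An interpretation must be symmetric and irreflexive on all coloured graphs, not only on
    encodings; hence the inequality and both orders. *)
Definition FPsi k := FAnd (FNot (FEq 0 1)) (FOr (FEdge k 0 1) (FEdge k 1 0)).

Lemma sat_psi (H : cgraph) k (u v : H) :
  sat (FPsi k) (env2 u v) = (u != v) && (edge_sem k u v || edge_sem k v u).
Proof.
have E x y (e : nat -> H) : x < 2 -> y < 2 -> sat (FEdge k x y) e = edge_sem k (e x) (e y).
  by move=> hx hy; rewrite /FEdge sat_xor sat_flip /edge_sem -!sat_decode.
rewrite -[LHS]/(~~ (u == v) && (sat (FEdge k 0 1) (env2 u v) || sat (FEdge k 1 0) (env2 u v))).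
by rewrite !E.
Qed.

Lemma psi_fv k : all (fun x => x < 2) (fv (FPsi k)).
Proof. by have [h1 h2] := fv_flip k; rewrite /= !all_cat /= !all_cat h1 h2. Qed.

Lemma psi_sym k (H : cgraph) (u v : H) : sat (FPsi k) (env2 u v) = sat (FPsi k) (env2 v u).
Proof. by rewrite !sat_psi eq_sym orbC. Qed.

Lemma psi_irr k (H : cgraph) (u : H) : ~~ sat (FPsi k) (env2 u u).
Proof. by rewrite sat_psi eqxx. Qed.

Definition flip_interp k : interpretation :=
  @Interp (FPsi k) (FCol 0 0) (psi_fv k) isT (@psi_sym k) (@psi_irr k).

(** * Correctness of the encoding *)

Section Encoding.
Variables (V : finType) (R : 'I_3 -> rel V) (K : nat) (p : V -> 'I_K) (F : rel 'I_K).

(** Here [c] is the colour minus 7: an even [c] stores an entry of the row of [F] at [p u], an odd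
    one tests the part itself. *)
Definition flip_mark (c : nat) (u : V) : bool :=
  if odd c then val (p u) == c./2 else [exists i : 'I_K, (val i == c./2) && F (p u) i].

Definition encoding_col (c : nat) (z : gadget R) : bool :=
  match z with
  | inl u => (c == 0) || (6 < c) && flip_mark (c - 7) u
  | inr (l, _, _, x) => c == ((val l).*2 + x).+1
  end.

Definition encoding : cgraph := @CGraph (gadget R) encoding_col.

Lemma encoding_arc (l : 'I_3) u v : @marked_path encoding l (inl u) (inl v) = R l u v.
Proof.
(* Arc colours lie between 1 and 6, and no base vertex carries such a colour. *)
have l6 : l.*2.+2 <= 6 by have := ltn_ord l; lia.
apply/existsP/idP => [[z /existsP[w]]|uv].
  case/andP => /andP[uz cz] /andP[/andP[zw cw] wv].
  case: z uz cz zw => [z|[[[l1 a1] b1] x1]] //= /andP[_ /eqP ua1] /eqP[e1].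
  case: w cw wv => [w|[[[l2 a2] b2] x2]] /=.
    by rewrite ltnNge l6.
  move=> /eqP[e2] /andP[h2 /eqP vb2] /and3P[/eqP[el ea eb] _ _].
  (* Parity of the colours tells the two halves apart, which fixes the direction of the arc. *)
  have x10 : x1 = false by move/(congr1 odd): e1; rewrite oddD !odd_double; case: (x1).
  have x21 : x2 = true by move/(congr1 odd): e2; rewrite /= oddD !odd_double; case: (x2).
  have ll : l = l1 by apply/val_inj/double_inj; rewrite e1 x10 addn0.
  by rewrite x10 /= in ua1; rewrite x21 in vb2; rewrite ua1 vb2 ea ll el.
exists (inr (l, u, v, false)); apply/existsP; exists (inr (l, u, v, true)).
by rewrite /= uv /= !eqxx /= addn0 addn1 !eqxx.
Qed.

Lemma encoding_flip u v : @flip_sem encoding K (inl u) (inl v) = F (p u) (p v).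
Proof.
have c1 j : @col encoding (j.*2 + 7) (inl u) = [exists i : 'I_K, (val i == j) && F (p u) i].
  rewrite /col /= /encoding_col addn_eq0 andbF /= addnK ltn_addl //=.
  by rewrite /flip_mark odd_double doubleK.
have c2 j : @col encoding (j.*2 + 8) (inl v) = (val (p v) == j).
  rewrite /col /= /encoding_col addn_eq0 andbF /= -[8]/(1 + 7) addnA addnK addn1.
  by rewrite ltn_addl //= /flip_mark /= odd_double /= uphalf_double.
apply/hasP/idP => [[j _]|h].
  rewrite c1 c2 => /andP[/existsP[i /andP[/eqP ij hF]] /eqP vj].
  by rewrite (_ : p v = i) //; apply/val_inj; rewrite ij vj.
exists (val (p v)); first by rewrite mem_iota /=.
by rewrite c1 c2 eqxx andbT; apply/existsP; exists (p v); rewrite eqxx.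
Qed.

Lemma encoding_decode u v : @decode_sem encoding (inl u) (inl v) =
  [exists s, R (inord 0) u s && R (inord 1) s v] (+) R (inord 2) u v.
Proof.
have arcE i a b : i < 3 -> @marked_path encoding i (inl a) (inl b) = R (inord i) a b.
  by move=> i3; rewrite -encoding_arc inordK.
rewrite /decode_sem arcE //; congr (_ (+) _).
apply/existsP/existsP => -[s].
  by case: s => [s|[[[l a] b] x]] //=; rewrite !arcE // => h; exists s.
by move=> h; exists (inl s); rewrite /= !arcE.
Qed.

End Encoding.

Section EncodeFlip.
Variables (G : graph) (R : 'I_3 -> rel G) (K : nat) (p : G -> 'I_K) (F : rel 'I_K).
Hypothesis Fsym : symmetric F.
Hypothesis R_decode : forall u v : G,
  ([exists s, R (inord 0) u s && R (inord 1) s v] (+) R (inord 2) u v) ||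
  ([exists s, R (inord 0) v s && R (inord 1) s u] (+) R (inord 2) v u) = gadj u v.

Lemma iso_encoding (G0 : graph) : iso G0 (flip_graph p Fsym) ->
  iso G0 (interp_graph (flip_interp K) (encoding R p F)).
Proof.
move=> [f [bf hf]]; pose IG := interp_graph (flip_interp K) (encoding R p F).
pose g (u : G) : IG := Sub (inl u : encoding R p F) isT.
have vg u : val (g u) = inl u by [].
pose h (x : IG) : G := base (val x).
have gK : cancel g h by [].
have hK : cancel h g.
  move=> x; apply: val_inj; rewrite vg /h; have := valP x.
  by case: (val x) => [u|[[[l a] b] y]].
exists (g \o f); split; first by apply: bij_comp bf; exists h.
move=> x y; rewrite hf /=; set u := f x; set v := f y.
rewrite /interp_adj (can_eq gK) /= /flip_adj; case: (eqVneq u v) => //= nuv.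
rewrite -[RHS]/(sat (FPsi K) (env2 (inl u : encoding R p F) (inl v : encoding R p F))).
rewrite sat_psi /edge_sem !encoding_decode !R_decode !encoding_flip.
by rewrite (@gadj_sym G v) (Fsym (p v)) orbb (inj_eq (@inl_inj _ _)) nuv.
Qed.

End EncodeFlip.

Lemma perturbation_interpretable (C D : gclass) :
  locally_almost_near_covered D -> perturbation C D ->
  exists D' : cgclass, tree_rank_le2 D' /\ interpretable C D'.
Proof.
move=> [k [m hD]] [K hC].
pose good (G : graph) (S : {set G}) (rep : G -> G) :=
  [/\ {in S, forall s, high k s},
      {in S &, forall x y, x != y -> ~~ near_twins (k 4) x y},
      forall u, high k u -> rep u \in S &
      forall u, high k u -> near_twins (k 4) u (rep u)].
exists (fun H => exists (G : graph) (S : {set G}) (rep : G -> G) (p : G -> 'I_K) (F : rel 'I_K),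
  [/\ D G, good G S rep & H = encoding (sparse_rel k S rep) p F]); split.
  (* Children lie within [r.+1] gadget steps of the root, and each step projects to distance at most
     3 in [G]. *)
  move=> r; pose R := 3 * r.+1.
  (* The summands dominate the degree threshold for base vertices, the number of vertices above it,
     and the degree of subdivision vertices. *)
  pose b := sparse_deg_bound k m R + sparse_count_bound k m R + 2.
  exists b.+1 => _ [G [S [rep [p [F [DG [hS1 hS2 hS3 hS4] ->]]]]]].
  move=> /T2_minor_many_high[] // x; apply/negP; rewrite -ltnNge ltnS.
  have local := fun r => hD r G DG.
  have := few_sparse_high local hS1 hS2 hS3 hS4 R (base x).
  set A := [set u in _ | _] => cA.
  apply: (@leq_trans #|A|); last by apply: leq_trans cA _; rewrite /b -addnA addnCA leq_addr.
  rewrite -(card_imset _ (inl_inj (A := G) (B := 'I_3 * G * G * bool))).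
  apply/subset_leq_card/subsetP => z; rewrite in_set => /andP[zb].
  case: z zb => [u ub hu|t _ ht]; last first.
    by have := leq_trans ht (gadget_degree_inr _ t); rewrite /b /= ltnNge leq_addl.
  apply/imsetP; exists u => //; rewrite in_set; apply/andP; split.
    apply: (@base_ball _ _ _ 3 r.+1 x (inl u)) => // l a a'.
    exact: sparse_rel_ball.
  apply: leq_trans (leq_trans hu (gadget_degree_inl _ u)).
  by rewrite /b /= ltnS -addnA leq_addr.
exists (flip_interp K) => G0 /hC[G [DG [p [F [Fsym isoG]]]]].
have [S [sS indS covS]] := maximal_independent [set u : G | high k u]
  (@near_twins_sym G (k 4)) (@near_twins_refl G (k 4)).
have /fin_all_exists[rep hrep] (u : G) :
    exists s, high k u -> s \in S /\ near_twins (k 4) u s.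
  case: (boolP (high k u)) => hu; last by exists u.
  by have [|s sS' us] := covS u; [rewrite in_set | exists s].
have gS : good G S rep.
  split=> // [s /(subsetP sS)|u /hrep[]|u /hrep[]] //; by rewrite in_set.
exists (encoding (sparse_rel k S rep) p F); split; first by exists G, S, rep, p, F.
apply: (iso_encoding (Fsym := Fsym)) => // u v.
by case: gS => h1 h2 h3 h4; apply: decodeE.
Qed.

Theorem theorem1p5 (C : gclass) :
  (exists D : cgclass, tree_rank_le2 D /\ interpretable C D) <->
  (exists D : gclass, locally_almost_near_covered D /\ perturbation C D).
Proof.
split=> -[D [hD hC]]; first exact: interpretable_perturbation hC.
exact: perturbation_interpretable hC.
Qed.
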